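(* Let $S:X\rightrightarrows Y$ be a set-valued mapping between reflexive Banach spaces, let $\Omega\subset X$, and let $(\bar x,\bar y)\in\operatorname{gph}S|_\Omega$. Consider the following statements: (i) $S$ has the Lipschitz-like property relative to $\Omega$ around $(\bar x,\bar y)$. (ii) $S$ is PSNC at $(\bar x,\bar y)$ relative to $\Omega$ and $\|D^{c*}_\Omega S(\bar x|\bar y)\|<\infty$. (iii) $S$ is PSNC at $(\bar x,\bar y)$ relative to $\Omega$ and $D^{c*}_\Omega S(\bar x|\bar y)(0)=\{0\}$. Then: (a) (i)$\Rightarrow$(ii)$\Rightarrow$(iii). (b) If in addition $\Omega$ is closed and convex and $\operatorname{gph}S$ is locally closed around $(\bar x,\bar y)$, then also (iii)$\Rightarrow$(i). (c) If $\Omega$ is closed and convex, $\operatorname{gph}S$ is locally closed around $(\bar x,\bar y)$, and $\dim X<\infty$, then $$\operatorname{lip}_\Omega S(\bar x,\bar y)\le\|\widetilde D^{c*}_\Omega S(\bar x|\bar y)\|.$$ (d) For $S$ between arbitrary reflexive Banach spaces $X$ and $Y$ and an arbitrary set $\Omega$, $$\|D^{c*}_\Omega S(\bar x|\bar y)\|\le\operatorname{lip}_\Omega S(\bar x,\bar y).$$ (e) If, in addition to the assumptions of (c), $S$ is coderivatively normal relative to $\Omega$ at $(\bar x,\bar y)$, then $$\operatorname{lip}_\Omega S(\bar x,\bar y)=\|D^{c*}_\Omega S(\bar x|\bar y)\|=\|\widetilde D^{c*}_\Omega S(\bar x|\bar y)\|.$$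
   Context: Conventions: every reflexive Banach space is equipped with an equivalent norm such that both the space and its dual are locally uniformly convex and the norm is Fréchet differentiable at each nonzero point. Products carry the norm $\|(x,y)\|=\sqrt{\|x\|^2+\|y\|^2}$, and similarly for duals. $\rightharpoonup^*$ is weak$^*$ sequential convergence. $\varepsilon_k\downarrow0$ means $\varepsilon_k\ge0$, $\varepsilon_k\to0$. $B_Y$ is the closed unit ball of $Y$. For $S:X\rightrightarrows Y$, $\operatorname{gph}S|_\Omega=\{(x,y)\mid x\in\Omega,\ y\in S(x)\}$. Duality mapping: $J(x)=\{x^*\in X^*\mid\langle x^*,x\rangle=\|x\|^2,\ \|x^*\|=\|x\|\}$; $J(A)=\bigcup_{x\in A}J(x)$. Tangent (contingent) cone: $w\in T(\bar x;\Omega)$ iff there are $t_k>0$, $t_k\to0$, $w_k\to w$ with $\bar x+t_kw_k\in\Omega$ for all $k$. For $\varepsilon\ge0$, $\Lambda\subset Z$, $\bar z\in\Lambda$, the $\varepsilon$-regular normal cone is $\widehat N^c_\varepsilon(\bar z;\Lambda)=\{z^*\in Z^*\mid\limsup_{z\to\bar z,\,z\in\Lambda}\frac{\langle z^*,z-\bar z\rangle}{\|z-\bar z\|}\le\varepsilon\|z^*\|\}$ (limsup over $z\ne\bar z$; vacuous if $\bar z$ is isolated in $\Lambda$). Lipschitz-like property: $S$ has the Lipschitz-like property relative to $\Omega$ around $(\bar x,\bar y)$ if there are neighborhoods $V$ of $\bar x$, $W$ of $\bar y$ and $\kappa\ge0$ with $S(x')\cap W\subset S(x)+\kappa\|x'-x\|B_Y$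 for all $x,x'\in\Omega\cap V$; $\operatorname{lip}_\Omega S(\bar x,\bar y)$ is the infimum of all $\kappa\ge0$ for which such $V,W$ exist ($\inf\emptyset=\infty$). Conic normal contingent coderivative $\widetilde D^{c*}_\Omega S(\bar x|\bar y):Y^*\rightrightarrows X^*$: $x^*\in\widetilde D^{c*}_\Omega S(\bar x|\bar y)(y^* )$ iff there exist $\varepsilon_k\downarrow0$, $(x_k,y_k)\in\operatorname{gph}S|_\Omega$ with $(x_k,y_k)\to(\bar x,\bar y)$, and $$(x_k^*,-y_k^* )\in\widehat N^c_{\varepsilon_k}\big((x_k,y_k);\operatorname{gph}S|_\Omega\big)\cap\big[J(T(x_k;\Omega))\times Y^*\big],\quad k\in\mathbb N,$$ with $x_k^*\rightharpoonup^*x^*$ and $y_k^*\rightharpoonup^*y^*$. The conic mixed contingent coderivative $D^{c*}_\Omega S(\bar x|\bar y):Y^*\rightrightarrows X^*$ is defined identically except that $y_k^*\to y^*$ strongly (while $x_k^*\rightharpoonup^*x^*$). The norm of a positively homogeneous multifunction $F$ (one with $0\in F(0)$, $F(\lambda x)=\lambda F(x)$ for $\lambda>0$) is $\|F\|=\sup\{\|y\|\mid y\in F(x),\ \|x\|\le1\}$. $S$ is coderivatively normal relative to $\Omega$ at $(\bar x,\bar y)$ if $\|D^{c*}_\Omega S(\bar x|\bar y)\|=\|\widetilde D^{c*}_\Omega S(\bar x|\bar y)\|$. $S$ is PSNC at $(\bar x,\bar y)$ relative to $\Omega$ if for all sequences $\varepsilon_k\downarrow0$, $(x_k,y_k)\in\operatorname{gph}S|_\Omega$,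 $(x_k,y_k)\to(\bar x,\bar y)$, $(x_k^*,-y_k^* )\in\widehat N^c_{\varepsilon_k}((x_k,y_k);\operatorname{gph}S|_\Omega)\cap[J(T(x_k;\Omega))\times Y^*]$ with $x_k^*\rightharpoonup^*0$ and $y_k^*\to0$, one has $\|x_k^*\|\to0$. *)

(* Defs.v *)
From HB Require Import structures.
From mathcomp Require Import all_boot all_order all_algebra.
From mathcomp Require Import all_classical all_reals all_analysis.

Set Implicit Arguments.
Unset Strict Implicit.
Unset Printing Implicit Defensive.

Import Order.TTheory GRing.Theory Num.Theory.
Import numFieldNormedType.Exports.

Local Open Scope classical_set_scope.
Local Open Scope ring_scope.

Section dual.
Context {R : realType} (X : normedModType R).

Definition continuous_linear : {pred X -> R^o} :=
  [pred f : X -> R^o | `[< linear f /\ continuous f >]].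

Structure dual : Type :=
  Dual { dual_fun :> X -> R^o ; _ : dual_fun \in continuous_linear }.

HB.instance Definition _ := [isSub for dual_fun].
HB.instance Definition _ := [Choice of dual by <:].

Lemma dual_linear (f : dual) : linear f.
Proof. by case: f => f /= /asboolP[]. Qed.

Lemma dual_continuous (f : dual) : continuous f.
Proof. by case: f => f /= /asboolP[]. Qed.

HB.instance Definition _ (f : dual) :=
  GRing.isLinear.Build R X R^o _ (dual_fun f) (dual_linear f).

Lemma dualE (f g : dual) : f =1 g -> f = g.
Proof. by move=> fg; exact/val_inj/funext. Qed.

Lemma continuous_linear_submod : submod_closed continuous_linear.
Proof.
split=> [|a f g /asboolP[fl fc] /asboolP[gl gc]]; apply/asboolP; split.
- by move=> a x y /=; rewrite scaler0 addr0.
- exact: cst_continuous.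
- move=> b x y; rewrite -[LHS]/(a *: f (b *: x + y) + g (b *: x + y)).
  rewrite fl gl -[in RHS]/(b *: (a *: f x + g x) + (a *: f y + g y)).
  by rewrite !scalerDr !scalerA (mulrC b) addrACA.
- by move=> x; apply: cvgD; [exact: cvgZr (fc x)|exact: gc].
Qed.

HB.instance Definition _ :=
  GRing.isSubmodClosed.Build R (X -> R^o) continuous_linear
    continuous_linear_submod.
HB.instance Definition _ := [SubChoice_isSubLmodule of dual by <:].

(* `R` rather than `R^o` as codomain, so that `sup` sees a set of reals *)
Definition dual_values (f : dual) : set R :=
  [set `|f x : R| | x in [set x : X | `|x| <= 1]].

Definition dual_norm (f : dual) : R := sup (dual_values f).

Lemma has_sup_dual_values (f : dual) : has_sup (dual_values f).
Proof.
split; first by exists `|f 0 : R|; exists 0; rewrite //= normr0.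
have /linear_bounded_continuous/bounded_funP/(_ 1)[M fM] :=
  @dual_continuous f.
by exists M => _ [x x1 <-]; exact: fM.
Qed.

Lemma dual_norm_ub (f : dual) (x : X) : `|x| <= 1 -> `|f x| <= dual_norm f.
Proof.
by move=> x1; apply: ub_le_sup; [case: (has_sup_dual_values f)|exists x].
Qed.

Lemma dual_norm_le (f : dual) (M : R) :
  (forall x, `|x| <= 1 -> `|f x| <= M) -> dual_norm f <= M.
Proof.
move=> fM; apply: ge_sup; first by case: (has_sup_dual_values f).
by move=> _ [x x1 <-]; exact: fM.
Qed.

Lemma dual_norm_ge0 (f : dual) : 0 <= dual_norm f.
Proof. by apply: le_trans (@dual_norm_ub f 0 _); rewrite ?normr0. Qed.

Lemma le_dual_norm (f : dual) (x : X) : `|f x| <= dual_norm f * `|x|.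
Proof.
have [->|x0] := eqVneq x 0; first by rewrite linear0 !normr0 mulr0.
have x_gt0 : 0 < `|x| by rewrite normr_gt0.
rewrite -ler_pdivrMr// mulrC.
have -> : `|x|^-1 * `|f x| = `|f (`|x|^-1 *: x)|.
  by rewrite linearZ/= normrZ gtr0_norm// invr_gt0.
by apply: dual_norm_ub; rewrite normrZ gtr0_norm ?invr_gt0// mulVf ?gt_eqF.
Qed.

Lemma dual_normD (f g : dual) : dual_norm (f + g) <= dual_norm f + dual_norm g.
Proof.
apply: dual_norm_le => x x1; rewrite (le_trans (ler_normD _ _))//.
by rewrite lerD// dual_norm_ub.
Qed.

Lemma dual_normZ_le (a : R) (f : dual) :
  dual_norm (a *: f) <= `|a| * dual_norm f.
Proof.
apply: dual_norm_le => x x1; rewrite -[X in `|X|]/(a * f x) normrM.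
by rewrite ler_wpM2l// dual_norm_ub.
Qed.

Lemma dual_normZ (a : R) (f : dual) : dual_norm (a *: f) = `|a| * dual_norm f.
Proof.
apply/eqP; rewrite eq_le dual_normZ_le/=.
have [->|a0] := eqVneq a 0; first by rewrite normr0 mul0r dual_norm_ge0.
rewrite -ler_pdivlMl ?normr_gt0// -normfV.
by rewrite -{1}[f]scale1r -(mulVf a0) -scalerA dual_normZ_le.
Qed.

Lemma dual_norm0_eq0 (f : dual) : dual_norm f = 0 -> f = 0.
Proof.
move=> f0; apply: dualE => x; apply/eqP; rewrite -normr_le0.
by rewrite (le_trans (le_dual_norm f x))// f0 mul0r.
Qed.

HB.instance Definition _ :=
  Lmodule_isNormed.Build R dual dual_normD dual_normZ dual_norm0_eq0.

Lemma dual_normE (f : dual) : `|f| = dual_norm f.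
Proof. by []. Qed.

End dual.

Section spaces.
Context {R : realType}.

Definition reflexive_space (X : normedModType R) : Prop :=
  forall F : dual (dual X), exists x : X, forall f : dual X, F f = f x.

Definition locally_uniformly_convex (X : normedModType R) : Prop :=
  forall x : X, `|x| = 1 -> forall e : R, 0 < e ->
    exists2 d : R, 0 < d &
      forall y : X, `|y| = 1 -> e <= `|x - y| -> `|2^-1 *: (x + y)| <= 1 - d.

Definition frechet_smooth_norm (X : normedModType R) : Prop :=
  forall x : X, x != 0 -> differentiable (fun z : X => `|z| : R^o) x.

Record renormed_reflexive (X : normedModType R) : Prop := RenormedReflexive {
  rr_reflexive : reflexive_space X ;
  rr_luc : locally_uniformly_convex X ;
  rr_dual_luc : locally_uniformly_convex (dual X) ;
  rr_smooth : frechet_smooth_norm X }.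

Definition finite_dimensional (X : normedModType R) : Prop :=
  exists (n : nat) (e : 'I_n -> X),
    forall x : X, exists c : 'I_n -> R, x = \sum_(i < n) c i *: e i.

Definition weak_star_cvg (X : normedModType R) (f_ : nat -> dual X)
    (f : dual X) : Prop :=
  forall x : X, f_ k x @[k --> \oo] --> f x.

Definition locally_closed_around (T : topologicalType) (A : set T) (z : T) :
    Prop :=
  exists U : set T, [/\ nbhs z U, closed U & closed (A `&` U)].

(* Meant for `F` with `0 \in F 0`; otherwise the supremum may be `-oo`. *)
Definition multi_norm (V W : normedModType R) (F : V -> set W) : \bar R :=
  ereal_sup [set r | exists x y, [/\ `|x| <= 1, F x y & r = `|y|%:E]].

Definition duality_map (X : normedModType R) (x : X) : set (dual X) :=
  [set f : dual X | f x = `|x| ^+ 2 /\ `|f| = `|x|].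

Definition duality_image (X : normedModType R) (A : set X) : set (dual X) :=
  \bigcup_(x in A) duality_map x.

Definition tangent_cone (X : normedModType R) (x : X) (Omega : set X) : set X :=
  [set w | exists (t_ : nat -> R) (w_ : nat -> X),
    [/\ forall k, 0 < t_ k, t_ @ \oo --> (0 : R), w_ @ \oo --> w
      & forall k, Omega (x + t_ k *: w_ k)]].

End spaces.

Section multifunctions.
Context {R : realType} {X Y : normedModType R}.
Implicit Types (S : X -> set Y) (Omega : set X) (xbar : X) (ybar : Y).

Definition graph S : set (X * Y) := [set z | S z.1 z.2].

Definition graph_on S Omega : set (X * Y) := [set z | Omega z.1 /\ S z.1 z.2].

(* The library norm on `X * Y` is the max norm, which has the right topology;
   the Euclidean product norm is needed in the normal cone only. *)
Definition l2norm (V W : normedModType R) (z : V * W) : R :=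
  Num.sqrt (`|z.1| ^+ 2 + `|z.2| ^+ 2).

Definition dual_pairing (zs : dual X * dual Y) (z : X * Y) : R :=
  zs.1 z.1 + zs.2 z.2.

(* The dual of `X * Y` is represented by `dual X * dual Y`.  The limsup is
   `-oo` when `z` is isolated in `A`, so the condition is then vacuous. *)
Definition eps_normal_cone (eps : R) (z : X * Y) (A : set (X * Y)) :
    set (dual X * dual Y) :=
  [set zs | (limf_esup
      (fun u : X * Y => (dual_pairing zs (u - z) / l2norm (u - z))%:E)
      (within A z^') <= (eps * l2norm zs)%:E)%E].

Definition lipschitz_modulus S Omega xbar ybar (kappa : R) : Prop :=
  0 <= kappa /\ exists (V : set X) (W : set Y),
    [/\ nbhs xbar V, nbhs ybar W &
      forall x x' : X, (Omega `&` V) x -> (Omega `&` V) x' ->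
        S x' `&` W `<=`
        [set y + (kappa * `|x' - x|) *: b
          | y in S x & b in [set b : Y | `|b| <= 1]]].

Definition lipschitz_like S Omega xbar ybar : Prop :=
  exists kappa, lipschitz_modulus S Omega xbar ybar kappa.

Definition lip S Omega xbar ybar : \bar R :=
  ereal_inf [set kappa%:E | kappa in lipschitz_modulus S Omega xbar ybar].

Record normal_sequence S Omega xbar ybar (eps_ : nat -> R) (x_ : nat -> X)
    (y_ : nat -> Y) (xs_ : nat -> dual X) (ys_ : nat -> dual Y) : Prop :=
  NormalSequence {
    ns_eps_ge0 : forall k, 0 <= eps_ k ;
    ns_eps_cvg : eps_ @ \oo --> (0 : R) ;
    ns_graph : forall k, graph_on S Omega (x_ k, y_ k) ;
    ns_cvg : (x_ k, y_ k) @[k --> \oo] --> (xbar, ybar) ;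
    ns_normal : forall k,
      (eps_normal_cone (eps_ k) (x_ k, y_ k) (graph_on S Omega) `&`
       (duality_image (tangent_cone (x_ k) Omega) `*` setT))
        (xs_ k, - ys_ k) }.

Definition normal_coderivative S Omega xbar ybar (ys : dual Y) :
    set (dual X) :=
  [set xs | exists eps_ x_ y_ xs_ ys_,
    [/\ normal_sequence S Omega xbar ybar eps_ x_ y_ xs_ ys_,
      weak_star_cvg xs_ xs & weak_star_cvg ys_ ys]].

Definition mixed_coderivative S Omega xbar ybar (ys : dual Y) :
    set (dual X) :=
  [set xs | exists eps_ x_ y_ xs_ ys_,
    [/\ normal_sequence S Omega xbar ybar eps_ x_ y_ xs_ ys_,
      weak_star_cvg xs_ xs & ys_ @ \oo --> ys]].

Definition coderivatively_normal S Omega xbar ybar : Prop :=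
  multi_norm (mixed_coderivative S Omega xbar ybar) =
  multi_norm (normal_coderivative S Omega xbar ybar).

Definition psnc S Omega xbar ybar : Prop :=
  forall eps_ x_ y_ xs_ ys_,
    normal_sequence S Omega xbar ybar eps_ x_ y_ xs_ ys_ ->
    weak_star_cvg xs_ 0 -> ys_ @ \oo --> (0 : dual Y) ->
    `|xs_ k| @[k --> \oo] --> (0 : R).

End multifunctions.

(* Main.v *)
(* The hard implication replaces a failure of the Lipschitz property, at points
   xh, x' of Omega and y' in S x', by a normal to the graph.  Apply Ekeland's
   principle to kappa |x - xh| + sqrt (|y - y'|^2 + d^2) on the graph, starting
   from (x', y'): at the approximate minimizer (x1, y1) the failure forces
   x1 <> xh, so the norm is differentiable at x1 - xh, and minus kappa times its
   derivative there lies in J (kappa (xh - x1) / |xh - x1|).  Since Omega is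
   convex, xh - x1 is tangent to Omega at x1, which is why exactly the normals
   restricted to J (T (x1; Omega)) occur.  Such normals have |xs| = kappa and
   |ys| <= 1; weak-star sequential compactness of bounded sequences then produces
   elements of the coderivatives.

   For the compactness, cluster points along ultrafilters exist trivially, and
   the difference of two of them lies in the norm closed span of the sequence by
   Hahn-Banach and reflexivity, so a subsequence that converges at countably many
   points norming the rational span converges everywhere. *)
Require Import Defs.
From HB Require Import structures.
From mathcomp Require Import all_boot all_order all_algebra.
From mathcomp Require Import all_classical all_reals all_analysis.
From mathcomp Require Import ring lra.

Set Implicit Arguments.
Unset Strict Implicit.
Unset Printing Implicit Defensive.

Import Order.TTheory GRing.Theory Num.Theory.
Import numFieldNormedType.Exports.
Local Open Scope classical_set_scope.
Local Open Scope ring_scope.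

(** * Hahn-Banach and weak-star sequential compactness *)

Section hahn_banach.
Context {R : realType} {V : lmodType R}.
Implicit Types p q : V -> R.

Definition sublinear p :=
  (forall x y, p (x + y) <= p x + p y) /\
  (forall a x, 0 <= a -> p (a *: x) <= a * p x).

Lemma sublinear0 p : sublinear p -> p 0 = 0.
Proof.
move=> [pD pZ]; apply/eqP; rewrite eq_le; apply/andP; split.
  by have := pZ 0 0 (lexx _); rewrite scale0r mul0r.
by have := pD 0 0; rewrite addr0; lra.
Qed.

Lemma sublinearN p x : sublinear p -> - p (- x) <= p x.
Proof.
move=> ps; have [pD _] := ps; have := pD x (- x).
by rewrite subrr sublinear0//; lra.
Qed.

Lemma sublinearZ p a x : sublinear p -> 0 <= a -> p (a *: x) = a * p x.
Proof.
move=> ps a0; have [_ pZ] := ps; apply/eqP; rewrite eq_le pZ//=.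
have [->|a_neq0] := eqVneq a 0; first by rewrite mul0r scale0r sublinear0.
have a_gt0 : 0 < a by rewrite lt_def a_neq0.
by rewrite -ler_pdivlMl// -{1}[x]scale1r -(mulVf a_neq0) -scalerA pZ// invr_ge0.
Qed.

(** The witness is [q x = inf (p (x + t *: v) - t * p v)] over [t >= 0]. Subadditivity bounds it
    below by [- p (- x)], and [t = 1] at [x = - v] gives the last claim. *)
Lemma sublinear_shift p v : sublinear p ->
  exists q, [/\ sublinear q, forall x, q x <= p x & q (- v) <= - p v].
Proof.
move=> ps; have [pD pZ] := ps.
pose E x := [set p (x + t *: v) - t * p v | t in [set t | 0 <= t]].
have E0 x : E x !=set0 by exists (p (x + 0 *: v) - 0 * p v); exists 0 => /=.
have lbE x : has_lbound (E x).
  exists (- p (- x)) => _ [t /= t0 <-].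
  have := pD (x + t *: v) (- x); rewrite addrAC subrr add0r sublinearZ//.
  by lra.
have Ele x t : 0 <= t -> inf (E x) <= p (x + t *: v) - t * p v.
  by move=> t0; apply: ge_inf => //; exists t.
exists (fun x => inf (E x)); split; last 2 first.
- by move=> x; have := Ele x 0 (lexx _); rewrite scale0r addr0 mul0r subr0.
- have := Ele (- v) 1 ler01; rewrite scale1r addNr mul1r sublinear0//.
  by rewrite sub0r.
split.
- move=> x y; rewrite -lerBlDr; apply: lb_le_inf => // _ [t /= t0 <-].
  rewrite lerBlDl -lerBlDr; apply: lb_le_inf => // _ [s /= s0 <-].
  have := Ele (x + y) (t + s) (addr_ge0 t0 s0).
  have := pD (x + t *: v) (y + s *: v).
  by rewrite addrACA scalerDl; lra.
- move=> a x; rewrite le_eqVlt => /predU1P[<-|a0].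
    by have := Ele 0 0 (lexx _); rewrite !scale0r addr0 !mul0r sublinear0// subr0.
  rewrite -ler_pdivrMl//; apply: lb_le_inf => // _ [t /= t0 <-].
  rewrite ler_pdivrMl//.
  have := Ele (a *: x) (a * t) (mulr_ge0 (ltW a0) t0).
  by rewrite -scalerA -scalerDr sublinearZ ?(ltW a0)// mulrBr mulrA.
Qed.

(* A minimal sublinear functional below [p] is linear, since shifting it in any
   direction cannot decrease it. *)
Lemma hahn_banach p v : sublinear p ->
  exists f : V -> R^o, [/\ linear f, forall x, f x <= p x & f v = p v].
Proof.
(* Minimizing below [p0] instead of [p] fixes the value at [v]: a linear [f <= p0] has
   [f (- v) <= - p v], hence [f v >= p v]. *)
move=> /(sublinear_shift v)[p0 [p0s p0p p0v]].
pose T := {q : V -> R | sublinear q /\ forall x, q x <= p0 x}.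
pose mkT q qs qp : T := exist _ q (conj qs qp).
(* The order is reversed, so the maximal element from Zorn's lemma is a minimal functional. *)
pose leT (s t : T) := `[< forall x, sval t x <= sval s x >].
have [| | |A Atot|m mmin] := @Zorn T leT.
- by move=> t; apply/asboolP.
- move=> r s t /asboolP rs /asboolP st; apply/asboolP => x.
  exact: le_trans (st x) (rs x).
- move=> [s Ps] [t Pt] /asboolP/= st /asboolP/= ts; apply: eq_exist.
  by apply/funext => x; apply/eqP; rewrite eq_le st ts.
- have [[a Aa]|A0] := pselect (A !=set0); last first.
    exists (mkT p0 p0s (fun x => lexx _)) => s As.
    by exfalso; apply: A0; exists s.
  (* A chain is bounded by its pointwise infimum; totality of the chain makes this infimum
     subadditive. *)
  pose E x := [set sval s x | s in A].
  have E0 x : E x !=set0 by exists (sval a x); exists a.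
  have lbE x : has_lbound (E x).
    exists (- p0 (- x)) => _ [s As <-].
    have [ss sp0] := svalP s; apply: le_trans (sublinearN x ss).
    by rewrite lerN2.
  have Ele x s : A s -> inf (E x) <= sval s x.
    by move=> As; apply: ge_inf => //; exists s.
  have qs : sublinear (fun x => inf (E x)).
    split.
    + move=> x y; rewrite -lerBlDr; apply: lb_le_inf => // _ [s As <-].
      rewrite lerBlDl -lerBlDr; apply: lb_le_inf => // _ [t At <-].
      rewrite lerBlDl; have [/asboolP st|/asboolP ts] := Atot s t As At.
      * apply: le_trans (Ele _ _ At) _; have [[tD _] _] := svalP t.
        by apply: le_trans (tD _ _) _; rewrite lerD2r.
      * apply: le_trans (Ele _ _ As) _; have [[sD _] _] := svalP s.
        by apply: le_trans (sD _ _) _; rewrite lerD2l.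
    + move=> b x; rewrite le_eqVlt => /predU1P[<-|b0].
        rewrite mul0r scale0r; apply: le_trans (Ele _ _ Aa) _.
        by have [/sublinear0 -> _] := svalP a.
      rewrite -ler_pdivrMl//; apply: lb_le_inf => // _ [s As <-].
      rewrite ler_pdivrMl//; apply: le_trans (Ele _ _ As) _.
      by have [[_ sZ] _] := svalP s; apply: sZ; exact: ltW.
  have qp0 x : inf (E x) <= p0 x.
    by apply: le_trans (Ele _ _ Aa) _; have [_] := svalP a.
  exists (mkT _ qs qp0) => s As; apply/asboolP => x /=.
  exact: Ele.
- have [ms mp0] := svalP m; set f := sval m in ms mp0 *.
  have fN x : f (- x) = - f x.
    apply/eqP; rewrite eq_le; apply/andP; split; last first.
      by rewrite lerNl; exact: sublinearN.
    have [q [qs qf qx]] := sublinear_shift x ms.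
    pose q' := mkT q qs (fun x => le_trans (qf x) (mp0 x)).
    have <- : sval q' = f.
      by rewrite /f (mmin q')//; apply/asboolP.
    by rewrite /= (le_trans qx)// lerN2.
  exists f; split.
  + move=> a x y.
    have fD u w : f (u + w) = f u + f w.
      apply/eqP; rewrite eq_le; have [-> _] := ms; rewrite andTb.
      (* Since [f] is odd, subadditivity at [- u] and [- w] is superadditivity at [u] and [w]. *)
      have [/(_ (- u) (- w)) + _] := ms.
      by rewrite -opprD !fN; lra.
    rewrite fD; congr (_ + _); have [a0|/ltW a0] := leP 0 a.
      exact: sublinearZ.
    rewrite -[a *: x]opprK fN -scaleNr sublinearZ// ?oppr_ge0//.
    by rewrite mulNr opprK.
  + by move=> x; exact: le_trans (mp0 x) (p0p x).
  + apply/eqP; rewrite eq_le (le_trans (mp0 v) (p0p v))/=.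
    by have := le_trans (mp0 (- v)) p0v; rewrite fN lerN2.
Qed.

End hahn_banach.

(** * Bounded functionals and their weak-star limits *)

Section dual_facts.
Context {R : realType} {X : normedModType R}.

Lemma dual_of_bounded (f : X -> R^o) (B : R) : linear f ->
  (forall x, `|f x| <= B * `|x|) -> exists g : dual X, g =1 f.
Proof.
move=> flin fB.
pose lf := GRing.isLinear.Build R X R^o _ f flin.
pose L : {linear X -> R^o} := HB.pack f lf.
have /(bounded_linear_continuous (f := L)) fc : bounded_near L (nbhs (0 : X)).
  apply/bounded_funP => r; exists (`|B| * r) => x xr.
  apply: le_trans (fB x) _; apply: le_trans (ler_norm _) _.
  by rewrite normrM normr_id ler_wpM2l.
have fP : f \in @continuous_linear R X by apply/asboolP; split.
by exists (Dual fP).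
Qed.

Lemma dualZ (f : dual X) a x : f (a *: x) = a * f x.
Proof. by rewrite linearZ. Qed.

Lemma cvgr_norm_le (T : Type) (F : set_system T) {FF : ProperFilter F}
    (u : T -> R) (l B : R) :
  u @ F --> l -> (forall t, `|u t| <= B) -> `|l| <= B.
Proof.
move=> ul uB.
by apply: (cvgr_to_le (cvg_norm ul)); near=> t; exact: uB.
Unshelve. all: by end_near. Qed.

(** Weak-star lower semicontinuity of the norm. The bounds may vary with [k] because the Lipschitz
    estimate on normals is only asymptotic. *)
Lemma weak_star_norm_le (f_ : nat -> dual X) (f : dual X) (b_ : nat -> R)
    (b : R) :
  weak_star_cvg f_ f -> (\forall k \near \oo, `|f_ k| <= b_ k) -> b_ @ \oo --> b ->
  `|f| <= b.
Proof.
move=> ff fb bb; apply: dual_norm_le => x x1.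
apply: (ler_cvg_to (cvg_norm (ff x)) bb); apply: filterS fb => k.
exact: le_trans (dual_norm_ub (f_ k) x1).
Qed.

Lemma ultra_bounded_cvg (T : Type) (U : set_system T) (u : T -> R) (B : R) :
  UltraFilter U -> (forall t, `|u t| <= B) -> exists l : R, u @ U --> l.
Proof.
move=> UU uB.
have [|l [_ lU]] := @segment_compact R (- B) B (u @ U) _.
  by apply: (@filterE _ U) => t; rewrite /= in_itv/= -ler_norml.
exists l => A Al.
have [//|UA] := in_ultra_setVsetC (u @^-1` A) UU.
by have [y []] := lU _ _ (UA : (u @ U) (~` A)) Al.
Qed.

(** Compactness of bounded intervals gives a limit at each [x]; linearity and the bound pass to the
    limit. *)
Lemma ultra_weak_star_limit (T : Type) (U : set_system T) (f_ : T -> dual X)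
    (B : R) : UltraFilter U -> (forall t, `|f_ t| <= B) ->
  exists f : dual X, forall x, f_ t x @[t --> U] --> f x.
Proof.
move=> UU fB.
have fxB x t : `|f_ t x| <= B * `|x|.
  by apply: le_trans (le_dual_norm _ _) _; rewrite ler_wpM2r// fB.
have /choice[g gP] x : exists l : R, f_ t x @[t --> U] --> l.
  exact: ultra_bounded_cvg (fxB x).
have [||f fg] := @dual_of_bounded g B.
- move=> a x y; have gaxy := gP (a *: x + y).
  have fE : (fun t => f_ t (a *: x + y)) = fun t => a * f_ t x + f_ t y.
    by apply/funext => t; rewrite linearP.
  rewrite fE in gaxy; apply: (cvg_unique _ gaxy) => //.
  exact: (cvgD (cvgM (cvg_cst a) (gP x)) (gP y)).
- by move=> x; apply: cvgr_norm_le (gP x) (fxB x).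
- by exists f => x; rewrite fg.
Qed.

End dual_facts.

(** * Extraction of weak-star convergent subsequences *)

Section weak_star_compactness.
Context {R : realType} {X : normedModType R}.
Variable f_ : nat -> dual X.

Definition lincomb n (c : nat -> R) : dual X := \sum_(i < n) c i *: f_ i.

(** The distance to the linear span of the [f_ i], used as the dominating functional in
    Hahn-Banach. *)
Definition dist_span (g : dual X) : R :=
  inf [set `|g - lincomb nc.1 nc.2| | nc in [set: nat * (nat -> R)]].

Lemma lincomb_widen n m c : (n <= m)%N ->
  exists d, lincomb n c = lincomb m d.
Proof.
move=> nm; exists (fun i => if (i < n)%N then c i else 0); rewrite /lincomb.
rewrite (big_ord_widen _ (fun i => c i *: f_ i) nm) big_mkcond/=.
by apply: eq_bigr => i _; case: ifPn; rewrite ?scale0r.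
Qed.

Lemma lincombD n c m d : exists k e, lincomb n c + lincomb m d = lincomb k e.
Proof.
have [c' ->] := lincomb_widen c (leq_maxl n m).
have [d' ->] := lincomb_widen d (leq_maxr n m).
exists (maxn n m), (fun i => c' i + d' i); rewrite /lincomb -big_split/=.
by apply: eq_bigr => i _; rewrite scalerDl.
Qed.

Lemma lincombZ a n c : a *: lincomb n c = lincomb n (fun i => a * c i).
Proof.
by rewrite /lincomb scaler_sumr; apply: eq_bigr => i _; rewrite scalerA.
Qed.

Let dist_set_lb (g : dual X) :
  has_lbound [set `|g - lincomb nc.1 nc.2| | nc in [set: nat * (nat -> R)]].
Proof. by exists 0 => _ [nc _ <-]. Qed.

Let dist_set_neq0 (g : dual X) :
  [set `|g - lincomb nc.1 nc.2| | nc in [set: nat * (nat -> R)]] !=set0.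
Proof. by exists `|g - lincomb 0 (fun=> 0)|; exists (0%N, fun=> 0). Qed.

Lemma dist_span_le g n c : dist_span g <= `|g - lincomb n c|.
Proof. by apply: ge_inf => //; exists (n, c). Qed.

Lemma dist_span_ge g a :
  (forall n c, a <= `|g - lincomb n c|) -> a <= dist_span g.
Proof. by move=> ga; apply: lb_le_inf => // _ [nc _ <-]. Qed.

Lemma sublinear_dist_span : sublinear dist_span.
Proof.
split=> [g h|a g a0].
- rewrite -lerBlDr; apply: dist_span_ge => n c; rewrite lerBlDl -lerBlDr.
  apply: dist_span_ge => m d; rewrite lerBlDr.
  have [k [e cd]] := lincombD n c m d.
  apply: le_trans (dist_span_le _ k e) _; rewrite -cd opprD addrACA addrC.
  by rewrite [leRHS]addrC addrC ler_normD.
- have [->|a_neq0] := eqVneq a 0.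
    rewrite mul0r scale0r (le_trans (dist_span_le _ 0 (fun=> 0)))//.
    by rewrite /lincomb big_ord0 subrr normr0.
  have a_gt0 : 0 < a by rewrite lt_def a_neq0.
  rewrite -ler_pdivrMl//; apply: dist_span_ge => n c; rewrite ler_pdivrMl//.
  apply: le_trans (dist_span_le _ n (fun i => a * c i)) _.
  by rewrite -lincombZ -scalerBr normrZ ger0_norm.
Qed.

Lemma dist_span_norm g : dist_span g <= `|g|.
Proof.
apply: le_trans (dist_span_le _ 0 (fun=> 0)) _.
by rewrite /lincomb big_ord0 subr0.
Qed.

Lemma dist_span_generator k a : dist_span (a *: f_ k) <= 0.
Proof.
apply: le_trans (dist_span_le _ k.+1 (fun i => if i == k then a else 0)) _.
rewrite /lincomb big_ord_recr/= eqxx big1 ?add0r ?subrr ?normr0// => i _.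
by rewrite ltn_eqF ?scale0r.
Qed.

(** Lists of rationals form a countable type, so these combinations can be enumerated by
    [unpickle]. *)
Definition rat_lincomb (r : seq rat) : dual X :=
  \sum_(i < size r) ratr r`_i *: f_ i.

Lemma rat_lincomb_dense n c e : 0 < e ->
  exists r, `|lincomb n c - rat_lincomb r| < e.
Proof.
move=> e0.
(* The length is kept in the induction so that [rcons] puts the new coefficient at index [n]. *)
suff [r [_ rP]] : exists r, size r = n /\ `|lincomb n c - rat_lincomb r| < e.
  by exists r.
elim: n e e0 => [|n IH] e e0.
  by exists [::]; rewrite /lincomb /rat_lincomb !big_ord0 subrr normr0.
have e20 : 0 < e / 2 by rewrite divr_gt0.
have [r [rn rP]] := IH _ e20.
(* The [+ 1] keeps the divisor positive when [f_ n = 0]. *)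
have M0 : 0 < `|f_ n| + 1 by rewrite ltr_wpDl.
have [q] : exists q : rat, ratr q \in `](c n - e / 2 / (`|f_ n| + 1)), c n[.
  by apply: rat_in_itvoo; rewrite ltrBlDr ltrDl divr_gt0.
rewrite in_itv/= => /andP[q1 q2]; exists (rcons r q).
rewrite size_rcons rn; split=> //.
have -> : rat_lincomb (rcons r q) = rat_lincomb r + ratr q *: f_ n.
  rewrite /rat_lincomb size_rcons big_ord_recr/= nth_rcons ltnn eqxx rn.
  by congr (_ + _); apply: eq_bigr => i _; rewrite nth_rcons rn ltn_ord.
have -> : lincomb n.+1 c = lincomb n c + c n *: f_ n by rewrite /lincomb big_ord_recr.
rewrite opprD addrACA -scalerBl.
rewrite (le_lt_trans (ler_normD _ _))// [ltRHS](splitr e).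
rewrite ltr_leD//.
rewrite normrZ gtr0_norm ?subr_gt0//.
have : c n - ratr q <= e / 2 / (`|f_ n| + 1) by lra.
rewrite ler_pdivlMr//; apply: le_trans.
by rewrite ler_wpM2l ?lerDl// subr_ge0 ltW.
Qed.

Lemma dist_span0_approx g e : dist_span g <= 0 -> 0 < e ->
  exists r, `|g - rat_lincomb r| < e.
Proof.
move=> g0 e0; have e20 : 0 < e / 2 by rewrite divr_gt0.
have /inf_lt/(_ (le_lt_trans g0 e20)) := dist_set_neq0 g.
move=> [_ [[n c] _ <-] /= gnc]; have [r rP] := rat_lincomb_dense n c e20.
exists r; rewrite -(subrK (lincomb n c) g) -addrA.
by rewrite (le_lt_trans (ler_normD _ _))// [ltRHS](splitr e) ltrD.
Qed.

(** Hahn-Banach applied to [dist_span] at [g] gives [F] with [F g = dist_span g] that vanishes on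
    every [f_ k]. By reflexivity [F] is evaluation at some [x]; every [f_ k] vanishes at [x], so
    [g x = 0]. *)
Lemma dist_span_annihilator (g : dual X) : reflexive_space X ->
  (forall x, (forall k, f_ k x = 0) -> g x = 0) -> dist_span g <= 0.
Proof.
move=> Xrefl g0; have [F [Flin Fle Fg]] := hahn_banach g sublinear_dist_span.
have FN h : F (- h) = - F h.
  have F00 : F 0 = 0.
    by have := Flin (- 1) 0 0; rewrite scaler0 addr0 scaleN1r addNr.
  by rewrite -scaleN1r -[_ *: h]addr0 Flin F00 addr0 scaleN1r.
have Fnorm h : `|F h| <= 1 * `|h|.
  rewrite mul1r ler_norml; apply/andP; split; last first.
    exact: le_trans (Fle _) (dist_span_norm _).
  rewrite lerNl -FN -[leRHS]normrN.
  exact: le_trans (Fle _) (dist_span_norm _).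
have [G GF] := dual_of_bounded Flin Fnorm.
have [x xP] := Xrefl G.
rewrite -Fg -GF xP g0// => k.
have F0 a : F (a *: f_ k) <= 0.
  exact: le_trans (Fle _) (dist_span_generator k a).
apply/eqP; rewrite eq_le -!xP GF.
have := F0 1; rewrite scale1r => -> /=.
by have := F0 (- 1); rewrite scaleN1r FN oppr_le0.
Qed.

End weak_star_compactness.
(** A sequential Banach-Alaoglu theorem for reflexive spaces. The condition [k <= phi k] is enough
    for limits to pass to the extracted sequence. *)
Theorem bounded_weak_star_subsequence {R : realType} (X : normedModType R)
    (f_ : nat -> dual X) (B : R) :
  reflexive_space X -> (forall k, `|f_ k| <= B) ->
  exists (phi : nat -> nat) (f : dual X),
    (forall k, (k <= phi k)%N) /\ weak_star_cvg (f_ \o phi) f.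
Proof.
move=> Xrefl fB.
(* Points of the unit ball that nearly norm each combination; the factor 2 spares proving that the
   supremum is attained. *)
have /choice[x_ x_P] (r : seq rat) : exists x : X,
    `|x| <= 1 /\ `|rat_lincomb f_ r| <= 2 * `|rat_lincomb f_ r x|.
  apply: contrapT => /forallNP noX.
  have xlt x : `|x| <= 1 ->
      `|rat_lincomb f_ r x| < `|rat_lincomb f_ r| / 2.
    move=> x1; rewrite ltNge; apply/negP => rx; apply: (noX x); split=> //.
    by rewrite mulrC -ler_pdivrMr.
  have := xlt 0; rewrite normr0 => /(_ ler01).
  have : `|rat_lincomb f_ r| <= `|rat_lincomb f_ r| / 2.
    by apply: dual_norm_le => x /xlt/ltW.
  have := normr_ge0 (rat_lincomb f_ r 0); lra.
(* The points [x_ r] as a sequence; codes that decode to nothing default to [[::]]. *)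
pose pt n := x_ (odflt [::] (unpickle n)).
have [U [UU oU]] := ultraFilterLemma (F := \oo) _.
have [f0 f0P] := ultra_weak_star_limit UU fB.
(* A diagonal choice: [phi m] approximates the ultrafilter limit [f0] within [1 / (m + 1)] at the
   first [m + 1] points. *)
have /choice[phi phiP] m : exists k, (m <= k)%N /\
    forall n, (n <= m)%N -> `|f0 (pt n) - f_ k (pt n)| < m.+1%:R^-1.
  have mU : U [set k | (m <= k)%N] by apply: oU; exists m.
  have ptU n : U [set k | `|f0 (pt n) - f_ k (pt n)| < m.+1%:R^-1].
    by have /cvgrPdist_lt := f0P (pt n); apply; rewrite invr_gt0 ltr0n.
  have UF : Filter U by exact: filter_filter.
  have ptmU := @filter_forall _ 'I_m.+1 _ U UF (fun i => ptU i).
  have [k [mk kP]] := filter_ex (filterI mU ptmU); exists k; split=> // n nm.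
  exact: (kP (Ordinal (nm : (n < m.+1)%N))).
exists phi, f0; split=> [k|v]; first by have [] := phiP k.
apply/cvgrPdist_lt => e e0; apply: contrapT => nlim.
(* If convergence fails at [v], indices with error at least [e] occur beyond every rank. An
   ultrafilter containing them gives a second limit [h], equal to [f0] at all points [pt n] but not
   at [v]. *)
pose A := [set k | e <= `|f0 v - f_ (phi k) v|].
have FA : ProperFilter (within A \oo).
  apply: Build_ProperFilter => A0; apply: nlim; near=> k; rewrite ltNge; apply/negP; near: k.
  exact: A0.
have [G [GU AG]] := ultraFilterLemma FA.
have [h hP] := ultra_weak_star_limit GU (fun k => fB (phi k)).
have oG : \oo `<=` G by move=> P oP; apply: AG; apply: filterS oP => k Pk _.
have hpt n : h (pt n) = f0 (pt n).
  apply: (cvg_unique _ (hP (pt n))) => //.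
  apply/cvgrPdist_lt => d d0; apply: oG.
  have dN := near_infty_natSinv_lt (PosNum d0).
  near=> k; have [_ /(_ n) kP] := phiP k.
  have nk : (n <= k)%N by near: k; exact: nbhs_infty_ge.
  by apply: lt_trans (kP nk) _; near: k; exact: dN.
have hv : h v != f0 v.
  apply/eqP => hf; have /cvgrPdist_lt/(_ e e0) hlim := hP v.
  have GA : G A by apply: (AG A); exact: withinT.
  have [k []] := filter_ex (filterI GA hlim).
  by rewrite hf ltNge /A /= => ->.
pose g := h - f0.
have gE x : g x = h x - f0 x by [].
have : dist_span f_ g <= 0.
  apply: dist_span_annihilator => // x fx.
  have h0 : h x = 0.
    have := hP x; rewrite (_ : (fun t => _) = cst 0); last exact/funext.
    by move=> hx; apply: (cvg_unique _ hx) => //; exact: cvg_cst.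
  have f00 : f0 x = 0.
    have := f0P x; rewrite (_ : (fun t => _) = cst 0); last exact/funext.
    by move=> fx0; apply: (cvg_unique _ fx0) => //; exact: cvg_cst.
  by rewrite gE h0 f00 subrr.
move=> gspan; move/eqP: hv; apply.
apply/eqP; rewrite -subr_eq0 -gE.
suff -> : g = 0 by [].
apply/eqP; rewrite -normr_le0; apply/ler_addgt0Pr => d d0; rewrite add0r.
(* Since [g] vanishes at the norming point of the nearby combination, that combination has norm at
   most twice its distance to [g], and [g] at most three times this distance. *)
have [|r rP] := dist_span0_approx (e := d / 3) gspan; first by rewrite divr_gt0.
have [x1 xr] := x_P r.
have gx0 : g (x_ r) = 0.
  have := hpt (pickle r); rewrite /pt pickleK/= => hx.
  by rewrite -[LHS]/(h (x_ r) - f0 (x_ r)) hx subrr.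
have : `|rat_lincomb f_ r (x_ r)| <= `|g - rat_lincomb f_ r|.
  have := dual_norm_ub (g - rat_lincomb f_ r) x1.
  rewrite -[(g - _) (x_ r)]/(g (x_ r) - _) gx0 sub0r normrN.
  exact: le_trans.
have : `|g| <= `|g - rat_lincomb f_ r| + `|rat_lincomb f_ r|.
  by rewrite -{1}(subrK (rat_lincomb f_ r) g) ler_normD.
lra.
Unshelve. all: by end_near.
Qed.

(** * Norm convergence of functionals in finite dimension *)

Section finite_dimension.
Context {R : realType} {X : completeNormedModType R}.

(* By Baire's theorem one of the sets [\sum_i c_i e_i] with [|c_i| <= m], which
   are compact, contains a ball. *)
Lemma bounded_coordinates n (e : 'I_n -> X) :
  (forall x, exists c : 'I_n -> R, x = \sum_(i < n) c i *: e i) ->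
  exists K, forall x, `|x| <= 1 ->
    exists2 c : 'I_n -> R, x = \sum_(i < n) c i *: e i & forall i, `|c i| <= K.
Proof.
move=> espan.
pose T (v : 'rV[R]_n) : X := \sum_(i < n) v ord0 i *: e i.
pose F (m : nat) := T @` [set v : 'rV[R]_n | forall i, v ord0 i \in `[- m%:R, m%:R]%R].
have Tc : continuous T.
  apply: continuous_big => [|i _ v]; first exact: add_continuous.
  have vi := @coord_continuous R 1 n ord0 i v.
  exact: (@cvgZr_tmp _ _ _ (nbhs v) _ _ _ (e i) vi).
have Fc m : closed (F m).
  apply: compact_closed; first exact: norm_hausdorff.
  apply: continuous_compact; first exact: continuous_subspaceT.
  have := @rV_compact R n (fun=> `[- m%:R, m%:R]%classic).
  by apply=> i; exact: segment_compact.
have [m] : exists m, ~ dense (~` F m).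
  apply: contrapT => /forallNP Fd.
  have /Baire/(_ setT) : forall m, open (~` F m) /\ dense (~` F m).
    move=> m; split; first exact: closed_openC.
    by apply: contrapT; exact: Fd.
  case; [by exists 0|exact: openT|move=> x [_ xF]].
  have [c xc] := espan x.
  pose m := Num.bound (\sum_i `|c i|).
  apply: (xF m) => //; exists (\row_i c i) => [i|].
    rewrite mxE in_itv/= -ler_norml.
    apply: (@le_trans _ _ (\sum_i `|c i|)).
      by rewrite (bigD1 i)//= lerDl sumr_ge0.
    by apply/ltW/archi_boundP; rewrite sumr_ge0.
  by rewrite xc /T; apply: eq_bigr => i _; rewrite mxE.
move=> /denseNE[U [[a /open_nbhs_nbhs/nbhs_ballP[r /= r0 aU]] UF]].
have ballF z : `|a - z| < r -> F m z.
  move=> az; apply: contrapT => nFz.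
  have : (U `&` ~` F m) z by split=> //; apply: aU; rewrite -ball_normE.
  by rewrite UF.
(* [x = (2 / r) *: (T w - T v)], where [v] and [w] represent [a] and [a + (r / 2) *: x] with
   coordinates at most [m] in absolute value. *)
exists (2 / r * (m%:R + m%:R)) => x x1.
have [v vm va] : F m a by apply: ballF; rewrite subrr normr0.
have [w wm wax] : F m (a + (r / 2) *: x).
  apply: ballF; rewrite opprD addNKr normrN normrZ gtr0_norm ?divr_gt0//.
  have r2 : r / 2 < r by rewrite ltr_pdivrMr// ltr_pMr// ltr1n.
  by apply: le_lt_trans r2; rewrite ler_piMr// ltW// divr_gt0.
exists (fun i => 2 / r * (w ord0 i - v ord0 i)) => [|i].
  transitivity ((2 / r) *: (T w - T v)).
    rewrite wax va addrAC subrr add0r scalerA mulrA divfK ?gt_eqF//.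
    by rewrite divff ?scale1r.
  rewrite /T -sumrB scaler_sumr; apply: eq_bigr => i _.
  by rewrite -scalerBl scalerA.
rewrite normrM gtr0_norm ?divr_gt0//.
apply: ler_wpM2l; first by rewrite ltW// divr_gt0.
rewrite (le_trans (ler_normB _ _))// lerD//.
  by have := wm i; rewrite in_itv/= -ler_norml.
by have := vm i; rewrite in_itv/= -ler_norml.
Qed.

(** On the unit ball [f - f_ k] is at most [K] times the sum of its absolute values at the [e i],
    which tends to 0. *)
Lemma finite_dimensional_weak_star_cvg (f_ : nat -> dual X) (f : dual X) :
  finite_dimensional X -> weak_star_cvg f_ f -> f_ @ \oo --> f.
Proof.
move=> [n [e espan]] ff; have [K KP] := bounded_coordinates espan.
have sum0 : \sum_(i < n) K * `|f (e i) - f_ k (e i)| @[k --> \oo] --> (0 : R).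
  rewrite [X in _ --> X](_ : 0 = \sum_(i < n) K * `|f (e i) - f (e i)|); last first.
    by rewrite big1// => i _; rewrite subrr normr0 mulr0.
  apply: cvg_big => [|i _]; first exact: add_continuous.
  apply: cvgM; first exact: cvg_cst.
  by apply: cvg_norm; apply: cvgB; [exact: cvg_cst|exact: ff].
apply/cvgrPdist_le => d d0.
have /cvgrPdist_le/(_ d d0) := sum0; apply: filterS => k.
rewrite sub0r normrN => /(le_trans (ler_norm _)); apply: le_trans.
apply: dual_norm_le => x x1; have [c -> cK] := KP x x1.
rewrite linear_sum; apply: le_trans (ler_norm_sum _ _ _) _.
apply: ler_sum => i _; rewrite linearZ normrM ler_wpM2r//.
Qed.

End finite_dimension.

(** * Ekeland's principle and smooth norms *)

Section ekeland.
Context {R : realType}.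

(** Stated as a predicate so that Ekeland's principle can be applied on the product [X * Y]. *)
Definition cauchy_complete (V : normedModType R) :=
  forall u : nat -> V, cauchy_ex (u @ \oo) -> exists l : V, u @ \oo --> l.

Lemma prod_cauchy_complete (U V : completeNormedModType R) :
  cauchy_complete (U * V)%type.
Proof.
move=> u uc.
have /cauchy_cvg u1 : cauchy ((fst \o u) @ \oo).
  apply: cauchy_exP => e /uc[z zF]; exists z.1.
  by apply: (@filterS _ \oo _ _ _ _ zF) => n [].
have /cauchy_cvg u2 : cauchy ((snd \o u) @ \oo).
  apply: cauchy_exP => e /uc[z zF]; exists z.2.
  by apply: (@filterS _ \oo _ _ _ _ zF) => n [].
exists (lim ((fst \o u) @ \oo), lim ((snd \o u) @ \oo)).
have uE : u = fun n => ((u n).1, (u n).2) by apply/funext => n; case: (u n).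
by rewrite uE; exact: (cvg_pair u1 u2).
Qed.

(** Put [w] in [S z] when [phi w + lam * |w - z| <= phi z], and descend by nearly minimizing [phi]
    over [S] at each stage. The limit lies in every [S (u n)], and a strict improvement on it would
    contradict near minimality. *)
Lemma ekeland (V : normedModType R) (A : set V) (phi : V -> R) (z0 : V) (lam : R) :
  cauchy_complete V ->
  closed A -> continuous phi -> (forall z, 0 <= phi z) -> 0 < lam -> A z0 ->
  exists z1, [/\ A z1, phi z1 <= phi z0 &
    forall z, A z -> phi z1 <= phi z + lam * `|z - z1|].
Proof.
move=> Vc Acl phic phi0 lam0 Az0.
pose S z := [set w | A w /\ phi w + lam * `|w - z| <= phi z].
have Sxx z : A z -> S z z by move=> Az; split; rewrite // subrr normr0 mulr0 addr0.
have Strans x y z : S x y -> S y z -> S x z.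
  move=> [Ay xy] [Az yz]; split=> //.
  have : lam * `|z - x| <= lam * `|z - y| + lam * `|y - x|.
    rewrite -mulrDr ler_wpM2l// ?(ltW lam0)//.
    by rewrite (le_trans _ (ler_normD _ _))// addrA subrK.
  by move: xy yz; lra.
have Slb z : has_lbound [set phi w | w in S z].
  by exists 0 => _ [w _ <-].
(* The state carries its rank [n], which fixes the slack [1 / (n + 1)] of the next choice; outside
   [A] the choice is a dummy. *)
have next (p : nat * V) : {q : nat * V | q.1 = p.1.+1 /\ (A p.2 -> S p.2 q.2 /\
    forall w, S p.2 w -> phi q.2 <= phi w + p.1.+1%:R^-1)}.
  apply: cid; have [Ap|nAp] := pselect (A p.2); last by exists (p.1.+1, p.2).
  have hinf : has_inf [set phi w | w in S p.2].
    by split=> //; exists (phi p.2), p.2 => //; exact: Sxx.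
  have p0 : 0 < p.1.+1%:R^-1 :> R by rewrite invr_gt0.
  have [_ [w Sw <-] winf] := inf_adherent p0 hinf.
  exists (p.1.+1, w); split=> // _; split=> // v Sv.
  apply: le_trans (ltW winf) _; rewrite lerD2r.
  by apply: ge_inf => //; exists v.
have [u' [u0 uS]] := dependent_choice next (0%N, z0).
pose u n := (u' n).2.
have u1 n : (u' n).1 = n by elim: n => [|n IH]; rewrite ?u0// (uS n).1 IH.
have Au n : A (u n).
  by elim: n => [|n IH]; [rewrite /u u0|have [_ /(_ IH)[[]]] := uS n].
have Su n : S (u n) (u n.+1) by have [_ /(_ (Au n))[]] := uS n.
have uinf n w : S (u n) w -> phi (u n.+1) <= phi w + n.+1%:R^-1.
  by have [_ /(_ (Au n))[_]] := uS n; rewrite u1; apply.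
have Sle n m : (n <= m)%N -> S (u n) (u m).
  move=> /subnK <-; elim: (m - n)%N => [|k IH]; first exact: Sxx.
  by rewrite addSn; apply: Strans IH (Su _).
(* [phi] is nonincreasing along [u]: once [phi (u N)] is within [lam * e] of the infimum, all later
   terms stay within [e] of [u N]. *)
have [z uc] : exists z : V, u @ \oo --> z.
  apply: Vc => e e0.
  have hinf : has_inf (range (phi \o u)).
    by split; [exists (phi (u 0%N)), 0%N|exists 0 => _ [n _ <-]; exact: phi0].
  have [_ [N _ <-] Ninf] := inf_adherent (mulr_gt0 lam0 e0) hinf.
  exists (u N); exists N => // n /= Nn; rewrite -ball_normE/=.
  have [_ uNn] := Sle _ _ Nn.
  have : inf (range (phi \o u)) <= phi (u n).
    by apply: ge_inf; [case: hinf|exists n].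
  rewrite -(ltr_pM2l lam0) distrC.
  by move: Ninf uNn => /=; lra.
have Sz n : S (u n) z.
  split.
    by apply: (closed_cvg _ Acl _ _ uc); near=> k; exact: Au.
  have ucn : phi (u k) + lam * `|u k - u n| @[k --> \oo] -->
      phi z + lam * `|z - u n|.
    apply: cvgD; first exact: (cvg_comp _ _ uc (phic z)).
    apply: cvgM; first exact: cvg_cst.
    by apply: cvg_norm; apply: cvgB => //; exact: cvg_cst.
  apply: (cvgr_to_le ucn); near=> k.
  have nk : (n <= k)%N by near: k; exact: nbhs_infty_ge.
  by have [] := Sle _ _ nk.
have Az : A z by have [] := Sz 0%N.
exists z; split=> //.
  have [_] := Sz 0%N; rewrite {2}/u u0/=; apply: le_trans.
  by rewrite lerDl mulr_ge0// ltW.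
move=> w Aw; rewrite leNgt; apply/negP => wz.
have Szw : S z w by split=> //; exact: ltW.
(* By transitivity [w] lies in [S (u n)] for every [n], so [phi z <= phi (u n.+1) <= phi w + 1 / (n
   + 1)]. *)
have : phi z <= phi w.
  apply/ler_addgt0Pr => e e0.
  near \oo => n.
  have nE : n.+1%:R^-1 <= e.
    by apply/ltW; near: n; exact: (near_infty_natSinv_lt (PosNum e0)).
  apply: le_trans (lerD (lexx _) nE).
  apply: le_trans (uinf n w (Strans _ _ _ (Sz n) Szw)).
  have [_] := Sz n.+1; apply: le_trans.
  by rewrite lerDl mulr_ge0// ltW.
have : 0 <= lam * `|w - z| by rewrite mulr_ge0// ltW.
lra.
Unshelve. all: by end_near. Qed.

End ekeland.

(** * First-order upper bounds for smooth norms *)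

Section smooth_norm.
Context {R : realType} {X : normedModType R}.

Lemma small_scale (P : set X) (v : X) : nbhs 0 P -> exists2 t : R, 0 < t & P (t *: v).
Proof.
move=> /nbhs_ballP[d /= d0 dP].
have v1 : 0 < `|v| + 1 by rewrite ltr_wpDl.
exists (d / (`|v| + 1)); first by rewrite divr_gt0.
apply: dP; rewrite -ball_normE/= sub0r normrN normrZ gtr0_norm ?divr_gt0//.
by rewrite mulrAC ltr_pdivrMr// ltr_pM2l// ltrDl.
Qed.

(** Increments along [z] give [p z = |z|]; increments along [v], with the reverse triangle
    inequality, give [|p v| <= |v|]. Of the differentiability estimate only the upper half is
    kept. *)
Lemma norm_derivative (z : X) : frechet_smooth_norm X -> z != 0 ->
  exists p : dual X, [/\ `|p| = 1, p z = `|z| &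
    forall e, 0 < e -> \forall h \near (0 : X),
      `|z + h| <= `|z| + p h + e * `|h|].
Proof.
move=> smooth z0; have dz := smooth z z0.
pose D := 'd (fun z : X => `|z| : R^o) z.
have DP : (D : X -> R^o) \in @continuous_linear R X.
  by apply/asboolP; split; [exact: linearP|exact: diff_continuous].
pose p := Dual DP.
have pE : forall e, 0 < e -> \forall h \near (0 : X),
    `| `|z + h| - `|z| - p h | <= e * `|h|.
  move=> e e0; have /diff_locally/eqaddoP/(_ e e0) := dz.
  apply: filterS => h; rewrite -[X in `|X| <= _ -> _]/(`|h + z| - (`|z| + D h)).
  by rewrite (addrC h z) opprD addrA.
have zn : 0 < `|z| by rewrite normr_gt0.
have pz : p z = `|z|.
  apply/eqP; rewrite eq_sym -subr_eq0 -normr_le0; apply/ler_addgt0Pr => e e0.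
  have [t t0] := small_scale z (pE _ (divr_gt0 e0 zn)).
  have -> : z + t *: z = (1 + t) *: z by rewrite scalerDl scale1r.
  rewrite dualZ !normrZ (gtr0_norm t0) gtr0_norm ?addr_gt0//.
  have -> : (1 + t) * `|z| - `|z| - t * p z = t * (`|z| - p z) by ring.
  have -> : e / `|z| * (t * `|z|) = t * e by field; rewrite gt_eqF.
  by rewrite normrM (gtr0_norm t0) ler_pM2l// add0r.
have pv v : `|p v| <= `|v|.
  apply/ler_addgt0Pr => e e0.
  have v1 : 0 < `|v| + 1 by rewrite ltr_wpDl.
  have [t t0] := small_scale v (pE _ (divr_gt0 e0 v1)).
  rewrite dualZ normrZ (gtr0_norm t0) => tP.
  have tv : `| `|z + t *: v| - `|z| | <= t * `|v|.
    apply: le_trans (ler_dist_dist _ _) _.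
    by rewrite addrAC subrr add0r normrZ gtr0_norm.
  have ev : e / (`|v| + 1) * `|v| <= e.
    by rewrite mulrAC ler_pdivrMr// ler_pM2l// lerDl.
  rewrite -(ler_pM2l t0) -{1}(gtr0_norm t0) -normrM.
  have -> : t * p v = `|z + t *: v| - `|z| - (`|z + t *: v| - `|z| - t * p v).
    by ring.
  apply: le_trans (ler_normB _ _) _; rewrite mulrDr lerD//.
  by apply: le_trans tP _; rewrite mulrCA ler_pM2l.
exists p; split=> //.
  apply/eqP; rewrite eq_le; apply/andP; split.
    by apply: dual_norm_le => v v1; exact: le_trans (pv v) v1.
  have := le_dual_norm p z; rewrite pz normr_id.
  by rewrite -[leLHS]mul1r ler_pM2r.
move=> e e0; apply: filterS (pE e e0) => h hP.
by have := le_trans (ler_norm _) hP; lra.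
Qed.

(** Smoothness says nothing at 0; multiplying by [|z|] makes the estimate trivial there. *)
Lemma norm_upper_model (z : X) : frechet_smooth_norm X ->
  exists2 p : dual X, `|p| <= 1 &
    forall e, 0 < e -> \forall h \near (0 : X),
      `|z| * (`|z + h| - `|z|) <= `|z| * (p h + e * `|h|).
Proof.
move=> smooth; have [->|z0] := eqVneq z 0.
  exists 0 => [|e e0]; first by rewrite normr0.
  by near=> h; rewrite !normr0 !mul0r.
have [p [p1 _ pP]] := norm_derivative smooth z0.
exists p => [|e e0]; first by rewrite p1.
apply: filterS (pP e e0) => h hP.
by apply: ler_wpM2l => //; rewrite lerBlDl addrA.
Unshelve. all: by end_near. Qed.

(** Concavity of the square root, from the nonnegative square of the difference of the two roots. *)
Lemma sqrt_le_tangent (a b : R) : 0 < a -> 0 <= b ->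
  Num.sqrt b <= Num.sqrt a + (b - a) / (2 * Num.sqrt a).
Proof.
move=> a0 b0; have sa : 0 < Num.sqrt a by rewrite sqrtr_gt0.
rewrite -lerBlDl ler_pdivlMr ?mulr_gt0//.
have := sqr_ge0 (Num.sqrt b - Num.sqrt a).
have := sqr_sqrtr b0; have := sqr_sqrtr (ltW a0).
nra.
Qed.

(** The term [d ^+ 2] keeps the root smooth at [z = 0]. The derivative is [(|z| / G) *: p], and
    [|z| <= G] makes its norm at most 1. *)
Lemma hypot_upper_model (z : X) (d : R) : frechet_smooth_norm X -> 0 < d ->
  exists2 q : dual X, `|q| <= 1 &
    forall e, 0 < e -> \forall h \near (0 : X),
      Num.sqrt (`|z + h| ^+ 2 + d ^+ 2) <=
      Num.sqrt (`|z| ^+ 2 + d ^+ 2) + q h + e * `|h|.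
Proof.
move=> smooth d0; have [p p1 pP] := norm_upper_model z smooth.
have a0 : 0 < `|z| ^+ 2 + d ^+ 2 by rewrite ltr_wpDl ?sqr_ge0// exprn_gt0.
set G := Num.sqrt (`|z| ^+ 2 + d ^+ 2).
have G0 : 0 < G by rewrite sqrtr_gt0.
have zG : `|z| / G <= 1.
  rewrite ler_pdivrMr// mul1r -[`|z|](ger0_norm (normr_ge0 z)) -sqrtr_sqr.
  by apply: ler_wsqrtr; rewrite lerDl sqr_ge0.
exists ((`|z| / G) *: p) => [|e e0].
  have zG0 : 0 <= `|z| / G by rewrite divr_ge0// ltW.
  by rewrite normrZ (ger0_norm zG0) mulr_ile1.
(* Half of [e] pays for the expansion of the norm, the other half for the quadratic term, since
   [|h| ^+ 2 <= e * G * |h|] for small [h]. *)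
have e2 : 0 < e / 2 by rewrite divr_gt0.
have eG : 0 < e * G by rewrite mulr_gt0.
near=> h.
have hP : `|z| * (`|z + h| - `|z|) <= `|z| * (p h + e / 2 * `|h|).
  by near: h; exact: pP.
have hG : `|h| <= e * G by near: h; exact: nbhs0_le.
have b0 : 0 <= `|z + h| ^+ 2 + d ^+ 2 by rewrite addr_ge0 ?sqr_ge0.
apply: le_trans (sqrt_le_tangent a0 b0) _; rewrite -/G -[leRHS]addrA lerD2l.
rewrite ler_pdivrMr ?mulr_gt0//.
rewrite -[(_ *: p) h]/(`|z| / G * p h).
have -> : (`|z| / G * p h + e * `|h|) * (2 * G) =
    2 * (`|z| * p h) + 2 * (G * (e * `|h|)).
  by field; rewrite gt_eqF.
have zhh : (`|z + h| - `|z|) ^+ 2 <= `|h| ^+ 2.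
  rewrite -[leLHS]real_normK ?num_real// ler_sqr ?nnegrE//.
  by rewrite (le_trans (ler_dist_dist _ _))// addrAC subrr add0r.
have zG' : `|z| <= G by rewrite ler_pdivrMr// mul1r in zG.
have : `|h| * `|h| <= `|h| * (e * G) by rewrite ler_wpM2l.
have : `|z| * (e * `|h|) <= G * (e * `|h|).
  by rewrite ler_wpM2r// mulr_ge0// ltW.
move: hP zhh; rewrite !expr2; nra.
Unshelve. all: by end_near. Qed.

End smooth_norm.

(** * Normals to the graph *)

Section eps_normals.
Context {R : realType} {X Y : normedModType R}.
Implicit Types (z w : X * Y) (zs : dual X * dual Y) (A : set (X * Y)).

Lemma l2norm_ge0 z : 0 <= l2norm z. Proof. exact: sqrtr_ge0. Qed.

Lemma norm_le_l2norm z : `|z| <= l2norm z.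
Proof.
rewrite prod_normE ge_max; apply/andP; split.
  rewrite -[leLHS]ger0_norm// -sqrtr_sqr.
  by apply: ler_wsqrtr; rewrite lerDl sqr_ge0.
rewrite -[leLHS]ger0_norm// -sqrtr_sqr.
by apply: ler_wsqrtr; rewrite lerDr sqr_ge0.
Qed.

Lemma l2norm_le z : l2norm z <= `|z.1| + `|z.2|.
Proof.
rewrite -[leRHS]ger0_norm ?addr_ge0// -sqrtr_sqr.
apply: ler_wsqrtr; rewrite sqrrD lerD2r lerDl.
by rewrite mulrn_wge0// mulr_ge0.
Qed.

(** The limsup condition becomes a linear estimate with slack [d]. At [u = z] both sides vanish, so
    the punctured neighborhood becomes a full one. *)
Lemma eps_normal_coneP eps z A zs :
  eps_normal_cone eps z A zs <->
  forall d, 0 < d -> \forall u \near z, A u ->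
    dual_pairing zs (u - z) <= (eps * l2norm zs + d) * l2norm (u - z).
Proof.
split.
- rewrite /eps_normal_cone/= limf_esupE => supP d d0.
  have := le_lt_trans supP (_ : _ < (eps * l2norm zs + d)%:E)%E.
  rewrite lte_fin ltrDl => /(_ d0)/ereal_inf_lt[_ [P zP <-] Pd].
  have zP' : \forall u \near z, u != z -> A u -> P u by exact: zP.
  apply: filterS zP' => u uP Au.
  have [->|uz] := eqVneq u z.
    rewrite subrr /dual_pairing/= !linear0 addr0.
    by rewrite /l2norm/= !normr0 expr0n addr0 sqrtr0 mulr0.
  have uz0 : 0 < l2norm (u - z).
    by apply: lt_le_trans (norm_le_l2norm _); rewrite normr_gt0 subr_eq0.
  rewrite -ler_pdivrMr// -lee_fin.
  apply: le_trans (ltW Pd); apply: ereal_sup_ubound.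
  by exists u => //; exact: uP.
- move=> nP; rewrite /eps_normal_cone/= limf_esupE.
  apply/lee_addgt0Pr => d d0; rewrite -EFinD.
  apply: ge_ereal_inf; pose f u := dual_pairing zs (u - z) / l2norm (u - z).
  pose P := [set u | f u <= eps * l2norm zs + d].
  exists (ereal_sup [set (f u)%:E | u in P]); last first.
    by apply: ge_ereal_sup => _ [u Pu <-]; rewrite lee_fin.
  exists P => //.
  have : \forall u \near z, u != z -> A u -> P u; last by [].
  apply: filterS (nP d d0) => u uP uz Au.
  rewrite /P /f /= ler_pdivrMr; first exact: uP.
  by apply: lt_le_trans (norm_le_l2norm _); rewrite normr_gt0 subr_eq0.
Qed.

End eps_normals.

(** * Normals obtained from Ekeland's principle *)

Section variational.
Context {R : realType}.

Lemma convex_tangent (X : normedModType R) (Omega : set X) (x y : X) (a : R) :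
  convex_set Omega -> Omega x -> Omega y -> 0 < a ->
  tangent_cone x Omega (a *: (y - x)).
Proof.
move=> Ocvx Ox Oy a0.
(* With these steps along a constant direction the points are convex combinations of [x] and [y]. *)
exists (fun n => a^-1 * n.+1%:R^-1), (fun=> a *: (y - x)); split.
- by move=> n; rewrite mulr_gt0 ?invr_gt0.
- rewrite -(mulr0 a^-1); apply: cvgM; first exact: cvg_cst.
  exact: cvg_harmonic.
- exact: cvg_cst.
move=> n; have n0 : 0 <= n.+1%:R^-1 :> R by rewrite invr_ge0.
have n1 : n.+1%:R^-1 <= 1 :> R by rewrite invf_le1// ler1n.
have := Ocvx y x (Itv01 n0 n1); rewrite !inE => /(_ Oy Ox).
rewrite -[X in Omega X -> _]/(n.+1%:R^-1 *: y + (1 - n.+1%:R^-1) *: x).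
congr Omega; rewrite scalerA mulrAC mulVf ?gt_eqF// mul1r.
by rewrite scalerBl scale1r scalerBr addrCA.
Qed.

Context {X Y : completeNormedModType R}.

Lemma near_shift0 (x : X) (y : Y) (P : set X) :
  nbhs 0 P -> \forall u \near (x, y), P (u.1 - x).
Proof.
have c : (fun u : X * Y => u.1 - x) @ (x, y) --> (0 : X).
  rewrite -(subrr x); apply: cvgB; [exact: cvg_fst|exact: cvg_cst].
exact: c.
Qed.

Lemma variational_normal (S : X -> set Y) (Omega : set X) (U : set (X * Y))
    (xh x' : X) (y' : Y) (k k' eps : R) :
  frechet_smooth_norm X -> frechet_smooth_norm Y ->
  closed Omega -> convex_set Omega -> closed (graph S `&` U) ->
  Omega xh -> Omega x' -> S x' y' -> 0 < k -> k < k' -> 0 < eps ->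
  (forall y, S xh y -> k' * `|x' - xh| < `|y - y'|) ->
  (forall x y, `|x - xh| <= `|x' - xh| -> `|y - y'| <= k' * `|x' - xh| ->
    nbhs (x, y) U) ->
  exists x1 y1 xs ys,
    [/\ graph_on S Omega (x1, y1), `|x1 - xh| <= `|x' - xh|
      & `|y1 - y'| <= k' * `|x' - xh|] /\
    [/\ eps_normal_cone eps (x1, y1) (graph_on S Omega) (xs, - ys),
        duality_image (tangent_cone x1 Omega) xs, `|xs| = k & `|ys| <= 1].
Proof.
move=> Xs Ys Ocl Ocvx Ucl Oh O' S' k0 kk' eps0 far Unbhs.
set rho := `|x' - xh| in far Unbhs *.
have k'0 : 0 < k' by exact: lt_trans kk'.
have rho0 : 0 < rho.
  rewrite lt_def normr_ge0 andbT; apply/eqP => rho0.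
  move/normr0_eq0/subr0_eq : (rho0) => xx; rewrite xx in S'.
  by have := far _ S'; rewrite rho0 mulr0 subrr normr0 ltxx.
(* Chosen so that [phi (x', y') = k * rho + d = k' * rho]. Since [h2] is at least [d] and at least
   the norm, the minimizer satisfies [|x1 - xh| <= rho] and [|y1 - y'| <= k' * rho]. *)
pose d := (k' - k) * rho.
have d0 : 0 < d by rewrite mulr_gt0// subr_gt0.
pose A := graph_on S Omega `&` U.
have Acl : closed A.
  have -> : A = (fst @^-1` Omega) `&` (graph S `&` U).
    by apply/seteqP; split => [z [[]]|z [? []]].
  apply: closedI => //; apply: closed_comp => //= z _; exact: cvg_fst.
pose h2 (y : Y) := Num.sqrt (`|y| ^+ 2 + d ^+ 2).
pose phi (z : X * Y) := k * `|z.1 - xh| + h2 (z.2 - y').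
have h2d y : d <= h2 y.
  rewrite -[leLHS]gtr0_norm// -sqrtr_sqr.
  by apply: ler_wsqrtr; rewrite lerDr sqr_ge0.
have h2n y : `|y| <= h2 y.
  rewrite -[leLHS]ger0_norm// -sqrtr_sqr.
  by apply: ler_wsqrtr; rewrite lerDl sqr_ge0.
have phic : continuous phi.
  move=> z; apply: cvgD.
    apply: cvgM; first exact: cvg_cst.
    by apply: cvg_norm; apply: cvgB; [exact: cvg_fst|exact: cvg_cst].
  have c2 : `|w.2 - y'| @[w --> z] --> `|z.2 - y'|.
    by apply: cvg_norm; apply: cvgB; [exact: cvg_snd|exact: cvg_cst].
  have c3 : `|w.2 - y'| ^+ 2 + d ^+ 2 @[w --> z] --> `|z.2 - y'| ^+ 2 + d ^+ 2.
    by rewrite !expr2; apply: cvgD; [exact: cvgM|exact: cvg_cst].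
  exact: (cvg_comp _ _ c3 (@sqrt_continuous R _)).
have phi0 z : 0 <= phi z by rewrite addr_ge0 ?mulr_ge0 ?sqrtr_ge0// ltW.
have Az0 : A (x', y').
  split=> //; apply: nbhs_singleton; apply: Unbhs => //.
  by rewrite subrr normr0 mulr_ge0// ltW.
(* The total error is [eps * k]: half for Ekeland, a quarter for each of the two derivatives. It
   fits the normal cone because the dual norm of the pair is at least [|xs| = k]. *)
have lam0 : 0 < eps * k / 2 by rewrite divr_gt0// mulr_gt0.
have [[x1 y1] [[g1 U1] phi1 min1]] :=
  ekeland (@prod_cauchy_complete R X Y) Acl phic phi0 lam0 Az0.
have {}phi1 : phi (x1, y1) <= k' * rho.
  apply: le_trans phi1 _; rewrite /phi/= subrr /h2 normr0 expr0n add0r.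
  by rewrite sqrtr_sqr gtr0_norm// -mulrDl addrC subrK.
have y1y' : `|y1 - y'| <= k' * rho.
  apply: le_trans (h2n _) _; apply: le_trans phi1.
  by rewrite lerDr mulr_ge0// ltW.
have x1xh : `|x1 - xh| <= rho.
  rewrite -(ler_pM2l k0); move: phi1 (h2d (y1 - y')); rewrite /phi/= /d.
  lra.
have x1h : x1 - xh != 0.
  apply/eqP => /subr0_eq x1h; have [_ S1] := g1; rewrite x1h in S1.
  by have := far _ S1; rewrite ltNge y1y'.
have x1h0 : 0 < `|x1 - xh| by rewrite normr_gt0.
have [p [p1 pz pP]] := norm_derivative Xs x1h.
have [q q1 qP] := hypot_upper_model (y1 - y') Ys d0.
exists x1, y1, (- k *: p), q; split=> //.
have xsk : `|- k *: p| = k by rewrite normrZ p1 normrN mulr1 gtr0_norm.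
split=> //.
- apply/eps_normal_coneP => e e0.
  have e4 : 0 < eps / 4 by rewrite divr_gt0.
  have e4k : 0 < eps / 4 * k by rewrite mulr_gt0.
  have near1 := near_shift0 x1 y1 (pP _ e4).
  have near2 : \forall u \near (x1, y1), h2 (y1 - y' + (u.2 - y1)) <=
      h2 (y1 - y') + q (u.2 - y1) + eps / 4 * k * `|u.2 - y1|.
    have c : (fun u : X * Y => u.2 - y1) @ (x1, y1) --> (0 : Y).
      by rewrite -(subrr y1); apply: cvgB; [exact: cvg_snd|exact: cvg_cst].
    exact: (c _ (qP _ e4k)).
  (* Minimality holds on [A] only, so nearby graph points must be known to lie in [U]. *)
  have nearU : \forall u \near (x1, y1), U u by exact: Unbhs.
  near=> u => gu.
  have Uu : U u by near: u.
  have := min1 u (conj gu Uu).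
  have : h2 (y1 - y' + (u.2 - y1)) <=
      h2 (y1 - y') + q (u.2 - y1) + eps / 4 * k * `|u.2 - y1| by near: u.
  have : `|x1 - xh + (u.1 - x1)| <=
      `|x1 - xh| + p (u.1 - x1) + eps / 4 * `|u.1 - x1| by near: u.
  rewrite addrC addrA subrK [_ + (u.2 - y1)]addrC addrA subrK /phi/= => le1 le2 le3.
  have un1 : `|u.1 - x1| <= `|u - (x1, y1)|.
    by rewrite prod_normE le_max lexx.
  have un2 : `|u.2 - y1| <= `|u - (x1, y1)|.
    by rewrite prod_normE le_max lexx orbT.
  apply: le_trans (_ : eps * k * `|u - (x1, y1)| <= _); last first.
    apply: ler_pM => //; first by rewrite mulr_ge0// ltW.
      rewrite -[leLHS]addr0 lerD ?(ltW e0)// ler_pM2l// -[leLHS]xsk.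
      apply: le_trans (norm_le_l2norm _); by rewrite prod_normE le_max lexx.
    exact: norm_le_l2norm.
  rewrite -[leLHS]/(- k * p (u.1 - x1) + - q (u.2 - y1)).
  have := ler_wpM2l (ltW k0) le1.
  have := ler_wpM2l (ltW e4k) un1; have := ler_wpM2l (ltW e4k) un2.
  move: le2 le3; lra.
- exists ((k / `|x1 - xh|) *: (xh - x1)).
    exact: (convex_tangent Ocvx g1.1 Oh (divr_gt0 k0 x1h0)).
  have wk : `|(k / `|x1 - xh|) *: (xh - x1)| = k.
    by rewrite normrZ gtr0_norm ?divr_gt0// (distrC xh) divfK// gt_eqF.
  split; rewrite wk//.
  rewrite -[LHS]/(- k * p ((k / `|x1 - xh|) *: (xh - x1))) dualZ.
  have -> : xh - x1 = - 1 *: (x1 - xh) by rewrite scaleN1r opprB.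
  by rewrite dualZ pz; field; exact: lt0r_neq0.
Unshelve. all: by end_near.
Qed.

End variational.

(** * Norm bounds for normals under the Lipschitz-like property *)

Section lipschitz_normals.
Context {R : realType} {X Y : normedModType R}.
Variables (S : X -> set Y) (Omega : set X).

(** [xs] is dual to a tangent [w], so points [x + t_ n *: w_ n] lie in [Omega], and the Lipschitz
    property supplies values there within [kappa * (t_ n * |w_ n|)] of [y]. Testing the normal
    inequality on these pairs, dividing by [t_ n] and passing to the limit bounds [xs w = |w| ^+ 2],
    where [|w| = |xs|]. *)
Lemma lipschitz_normal_bound (V : set X) (W : set Y) (kappa eps : R) (x : X)
    (y : Y) (xs : dual X) (ys : dual Y) :
  0 <= kappa -> 0 <= eps ->
  (forall x x' : X, (Omega `&` V) x -> (Omega `&` V) x' ->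
    S x' `&` W `<=` [set y + (kappa * `|x' - x|) *: b
      | y in S x & b in [set b : Y | `|b| <= 1]]) ->
  nbhs x V -> W y -> graph_on S Omega (x, y) ->
  eps_normal_cone eps (x, y) (graph_on S Omega) (xs, - ys) ->
  duality_image (tangent_cone x Omega) xs ->
  `|xs| <= kappa * `|ys| + eps * (1 + kappa) * (`|xs| + `|ys|).
Proof.
move=> k0 eps0 lipS Vx Wy [Ox Sxy] /= /eps_normal_coneP nP.
move=> [w [t_ [w_ [t0 tcvg wcvg tO]]] [xsw xsn]].
set L := l2norm (xs, - ys) in nP.
have LP : L <= `|xs| + `|ys| by rewrite -[`|ys|]normrN; exact: l2norm_le.
have [w0|wn0] := eqVneq w 0.
  by rewrite xsn w0 normr0 add0r addr_ge0 ?mulr_ge0// addr_ge0.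
have w_gt0 : 0 < `|w| by rewrite normr_gt0.
suff main d : 0 < d ->
    `|w| <= kappa * `|ys| + (eps * L + d) * (1 + kappa).
  apply: (@le_trans _ _ (kappa * `|ys| + eps * L * (1 + kappa))); last first.
    by rewrite lerD2l mulrAC ler_wpM2l// mulr_ge0// addr_ge0.
  rewrite xsn; apply/ler_addgt0Pr => d d0.
  have k1 : 0 < 1 + kappa by rewrite ltr_wpDr.
  apply: le_trans (main (d / (1 + kappa)) (divr_gt0 d0 k1)) _.
  by rewrite mulrDl divfK ?gt_eqF// addrA.
move=> d0; set C := (X in _ <= X).
have /nbhs_ballP[r /= r0 rP] := nP d d0.
have twcvg : (t_ n *: w_ n) @[n --> \oo] --> (0 : X).
  by rewrite -(scale0r w); apply: cvgZ.
have xtw : (x + t_ n *: w_ n) @[n --> \oo] --> x.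
  by rewrite -[X in _ --> X]addr0; apply: cvgD => //; exact: cvg_cst.
have key : \forall n \near \oo, xs (w_ n) <= C * `|w_ n|.
  have Vn : \forall n \near \oo, V (x + t_ n *: w_ n) by exact: xtw.
  (* This radius puts both components of the test pair within [r]. *)
  have rk : 0 < r / (1 + kappa) by rewrite divr_gt0// ltr_wpDr.
  have /cvgr0Pnorm_lt/(_ _ rk) small := twcvg.
  near=> n.
  have Vw : V (x + t_ n *: w_ n) by near: n.
  have : `|t_ n *: w_ n| < r / (1 + kappa) by near: n.
  have k1 : 0 < 1 + kappa by rewrite ltr_wpDr.
  rewrite ltr_pdivlMr// mulrDr mulr1 => twr.
  have tw0 : 0 <= `|t_ n *: w_ n| * kappa by rewrite mulr_ge0.
  have OV : (Omega `&` V) (x + t_ n *: w_ n) by split.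
  have OVx : (Omega `&` V) x by split=> //; exact: nbhs_singleton.
  have [y1 Sy1 [b b1 yE]] := lipS _ _ OV OVx y (conj Sxy Wy).
  have xx : `|x - (x + t_ n *: w_ n)| = t_ n * `|w_ n|.
    by rewrite opprD addNKr normrN normrZ gtr0_norm.
  rewrite xx in yE.
  have y1y : `|y1 - y| <= kappa * (t_ n * `|w_ n|).
    rewrite -yE opprD addNKr normrN normrZ ger0_norm; last first.
      by rewrite !mulr_ge0// ltW.
    by rewrite ler_piMr// !mulr_ge0// ltW.
  have twE : `|t_ n *: w_ n| = t_ n * `|w_ n| by rewrite normrZ gtr0_norm.
  rewrite twE in twr tw0.
  have tw1 : 0 <= t_ n * `|w_ n| by rewrite mulr_ge0// ltW.
  have xyr : ball (x, y) r (x + t_ n *: w_ n, y1).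
    split; rewrite -ball_normE/= distrC.
      by rewrite addrAC subrr add0r twE; lra.
    by apply: le_lt_trans y1y _; rewrite mulrC; lra.
  have := rP _ xyr (conj OV.1 Sy1).
  rewrite -[X in X <= _ -> _]/(xs (x + t_ n *: w_ n - x) + - ys (y1 - y)).
  rewrite addrAC subrr add0r dualZ => pairP.
  have l2P : l2norm ((x + t_ n *: w_ n, y1) - (x, y)) <=
      (1 + kappa) * (t_ n * `|w_ n|).
    apply: le_trans (l2norm_le _) _ => /=.
    by rewrite addrAC subrr add0r twE mulrDl mul1r lerD2l.
  have epsL : 0 <= eps * L + d by rewrite addr_ge0 ?mulr_ge0 ?l2norm_ge0// ltW.
  have := ler_wpM2l epsL l2P.
  have ysP : ys (y1 - y) <= `|ys| * (kappa * (t_ n * `|w_ n|)).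
    apply: le_trans (ler_norm _) _; apply: le_trans (le_dual_norm _ _) _.
    by rewrite -dual_normE ler_wpM2l.
  move=> l2P'; rewrite -(ler_pM2l (t0 n)).
  have -> : t_ n * (C * `|w_ n|) = `|ys| * (kappa * (t_ n * `|w_ n|)) +
      (eps * L + d) * ((1 + kappa) * (t_ n * `|w_ n|)).
    by rewrite /C; ring.
  by move: pairP l2P' ysP; lra.
have : xs w <= C * `|w|.
  apply: ler_cvg_to (cvgM (cvg_cst C) (cvg_norm wcvg)) key.
  exact: (cvg_comp _ _ wcvg (@dual_continuous _ _ xs w)).
by rewrite xsw expr2 ler_pM2r.
Unshelve. all: by end_near. Qed.

(** The preceding bound has [|xs|] on both sides; once [eps_ k * (1 + kappa) < 1] it can be
    absorbed, and the resulting constants tend to [kappa]. *)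
Lemma normal_sequence_lipschitz xbar ybar kappa eps_ x_ y_ xs_ ys_ :
  lipschitz_modulus S Omega xbar ybar kappa ->
  normal_sequence S Omega xbar ybar eps_ x_ y_ xs_ ys_ ->
  exists2 b_ : nat -> R, b_ @ \oo --> kappa &
    \forall k \near \oo, `|xs_ k| <= b_ k * `|ys_ k|.
Proof.
move=> [k0 [V [W [Vx Wy lipS]]]] [eps0 epsc gr cv nrm].
pose c := 1 + kappa.
have c0 : 0 < c by rewrite ltr_wpDr.
have epsc0 : eps_ k * c @[k --> \oo] --> (0 : R).
  by rewrite -(mul0r c); apply: cvgM => //; exact: cvg_cst.
exists (fun k => (kappa + eps_ k * c) / (1 - eps_ k * c)).
  rewrite [X in _ --> X](_ : kappa = (kappa + 0) / (1 - 0)); last first.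
    by rewrite addr0 subr0 divr1.
  apply: cvgM; first by apply: cvgD => //; exact: cvg_cst.
  apply: cvgV; first by rewrite subr0 oner_neq0.
  by apply: cvgB => //; exact: cvg_cst.
have xc : x_ @ \oo --> xbar by exact: (cvg_comp _ _ cv cvg_fst).
have yc : y_ @ \oo --> ybar by exact: (cvg_comp _ _ cv cvg_snd).
have Vk : \forall k \near \oo, nbhs (x_ k) V.
  exact: (xc _ (nbhs_interior Vx)).
have Wk : \forall k \near \oo, W (y_ k) by exact: yc.
have e1 : \forall k \near \oo, eps_ k * c < 1 by exact: (cvgr_lt _ epsc0).
near=> k.
have ek : 0 < 1 - eps_ k * c by rewrite subr_gt0; near: k.
have [nk [/= Jk _]] := nrm k.
have Vxk : nbhs (x_ k) V by near: k.
have Wyk : W (y_ k) by near: k.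
have := lipschitz_normal_bound k0 (eps0 k) lipS Vxk Wyk (gr k) nk Jk.
rewrite -/c => bound; rewrite mulrAC ler_pdivlMr//; lra.
Unshelve. all: by end_near. Qed.

End lipschitz_normals.

(** * Coderivatives under the Lipschitz-like property *)

Section normal_sequences.
Context {R : realType} {X Y : normedModType R}.
Variables (S : X -> set Y) (Omega : set X) (xbar : X) (ybar : Y).

Lemma l2normZ (U V : normedModType R) (a : R) (z : U * V) :
  0 <= a -> l2norm (a *: z) = a * l2norm z.
Proof.
move=> a0; rewrite /l2norm/= !normrZ !exprMn -mulrDr ger0_norm//.
by rewrite sqrtrM ?sqr_ge0// sqrtr_sqr ger0_norm.
Qed.

(** The tolerance in the cone is relative to the norm of the normal, so scaling keeps the same
    [eps]. *)
Lemma eps_normal_coneZ eps z (A : set (X * Y)) xs ys (a : R) : 0 < a ->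
  eps_normal_cone eps z A (xs, - ys) ->
  eps_normal_cone eps z A (a *: xs, - (a *: ys)).
Proof.
move=> a0 /eps_normal_coneP zP; apply/eps_normal_coneP => d d0.
have := zP _ (divr_gt0 d0 a0); apply: filterS => u /[apply].
rewrite -(ler_pM2l a0) -scalerN -[(a *: xs, _)]/(a *: (xs, - ys)).
rewrite l2normZ ?(ltW a0)//; set L := l2norm (xs, _); set l := l2norm _.
have -> : a * ((eps * L + d / a) * l) = (eps * (a * L) + d) * l.
  by field; exact: lt0r_neq0.
have -> : dual_pairing (a *: (xs, - ys)) (u - z) =
  a * dual_pairing (xs, - ys) (u - z) by rewrite [RHS]mulrDr.
by [].
Qed.

Lemma duality_imageZ (x : X) (xs : dual X) (a : R) : 0 < a ->
  duality_image (tangent_cone x Omega) xs ->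
  duality_image (tangent_cone x Omega) (a *: xs).
Proof.
move=> a0 [w [t_ [w_ [t0 tc wc tO]]] [xsw xsn]].
exists (a *: w).
  exists (fun n => a^-1 * t_ n), (fun n => a *: w_ n); split.
  - by move=> n; rewrite mulr_gt0// invr_gt0.
  - by rewrite -(mulr0 a^-1); apply: cvgM => //; exact: cvg_cst.
  - by apply: cvgZ => //; exact: cvg_cst.
  - by move=> n; rewrite scalerA mulrAC mulVf ?gt_eqF// mul1r.
split; last by rewrite !normrZ xsn.
by rewrite dualZ -[(a *: xs) w]/(a * xs w) xsw normrZ gtr0_norm// exprMn; ring.
Qed.

Lemma normal_sequenceZ eps_ x_ y_ xs_ ys_ (a_ : nat -> R) :
  (forall k, 0 < a_ k) ->
  normal_sequence S Omega xbar ybar eps_ x_ y_ xs_ ys_ ->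
  normal_sequence S Omega xbar ybar eps_ x_ y_ (fun k => a_ k *: xs_ k)
    (fun k => a_ k *: ys_ k).
Proof.
move=> a0 [e0 ec gr cv nrm]; split=> // k; have [nk [Jk _]] := nrm k.
by split; [exact: eps_normal_coneZ|split=> //; exact: duality_imageZ].
Qed.

Lemma cvg_subsequence (phi : nat -> nat) :
  (forall k, (k <= phi k)%N) -> phi @ \oo --> \oo.
Proof.
move=> phik A [N _ NA]; exists N => // k /= Nk; apply: NA => /=.
exact: leq_trans (phik k).
Qed.

Lemma normal_sequence_sub eps_ x_ y_ xs_ ys_ (phi : nat -> nat) :
  (forall k, (k <= phi k)%N) ->
  normal_sequence S Omega xbar ybar eps_ x_ y_ xs_ ys_ ->
  normal_sequence S Omega xbar ybar (eps_ \o phi) (x_ \o phi) (y_ \o phi)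
    (xs_ \o phi) (ys_ \o phi).
Proof.
move=> /cvg_subsequence phic [e0 ec gr cv nrm]; split.
- by move=> k; exact: e0.
- exact: (cvg_comp _ _ phic ec).
- by move=> k; exact: gr.
- exact: (cvg_comp _ _ phic cv).
- by move=> k; exact: nrm.
Qed.

Lemma normal_sequence0 : graph_on S Omega (xbar, ybar) ->
  normal_sequence S Omega xbar ybar (fun=> 0) (fun=> xbar) (fun=> ybar)
    (fun=> 0) (fun=> 0).
Proof.
move=> gbar; split=> //; try exact: cvg_cst.
move=> k; split.
  apply/eps_normal_coneP => d d0; near=> u => _.
  rewrite oppr0 mul0r add0r -[leLHS]/(0 + 0) addr0.
  by rewrite mulr_ge0 ?l2norm_ge0// ltW.
split=> //=; exists 0; last first.
  by split; [rewrite linear0 normr0 expr0n|rewrite !normr0].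
exists harmonic, (fun=> 0); split.
- by move=> n; exact: harmonic_gt0.
- exact: cvg_harmonic.
- exact: cvg_cst.
- by move=> n; rewrite scaler0 addr0; case: gbar.
Unshelve. all: by end_near. Qed.

Let D := mixed_coderivative S Omega xbar ybar.
Let Dn := normal_coderivative S Omega xbar ybar.

Lemma mixed_coderivative00 : graph_on S Omega (xbar, ybar) -> D 0 0.
Proof.
move=> /normal_sequence0 ns0; do 5!eexists; split; first exact: ns0.
  by move=> x; exact: cvg_cst.
exact: cvg_cst.
Qed.

Lemma normal_coderivative00 : graph_on S Omega (xbar, ybar) -> Dn 0 0.
Proof.
move=> /normal_sequence0 ns0; do 5!eexists; split; first exact: ns0.
  by move=> x; exact: cvg_cst.
by move=> y; exact: cvg_cst.
Qed.

(** Strong convergence of [ys_] makes [|ys_ k|] tend to [|ys|]; for [xs_] lower semicontinuity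
    suffices. *)
Lemma mixed_coderivative_lipschitz kappa ys xs :
  lipschitz_modulus S Omega xbar ybar kappa -> D ys xs ->
  `|xs| <= kappa * `|ys|.
Proof.
move=> lipk [eps_ [x_ [y_ [xs_ [ys_ [ns xsc ysc]]]]]].
have [b_ bc bP] := normal_sequence_lipschitz lipk ns.
apply: (weak_star_norm_le xsc bP).
by apply: cvgM => //; exact: cvg_norm.
Qed.

Lemma multi_norm_le_lip :
  (multi_norm D <= lip S Omega xbar ybar)%E.
Proof.
apply: le_ereal_inf_tmp => _ [kappa lipk <-].
apply: ge_ereal_sup => _ [ys [xs [ys1 Dxs ->]]]; rewrite lee_fin.
apply: le_trans (mixed_coderivative_lipschitz lipk Dxs) _.
by rewrite ler_piMr//; case: lipk.
Qed.

Lemma lipschitz_like_psnc : lipschitz_like S Omega xbar ybar ->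
  psnc S Omega xbar ybar.
Proof.
move=> [kappa lipk] eps_ x_ y_ xs_ ys_ ns _ ys0.
have [b_ bc bP] := normal_sequence_lipschitz lipk ns.
have b0 : b_ k * `|ys_ k| @[k --> \oo] --> (0 : R).
  rewrite [X in _ --> X](_ : 0 = kappa * `|0 : dual Y|); last first.
    by rewrite normr0 mulr0.
  by apply: cvgM => //; exact: cvg_norm.
apply: (squeeze_cvgr _ (cvg_cst 0) b0).
by apply: filterS bP => k ->; rewrite normr_ge0.
Qed.

Lemma lipschitz_like_multi_norm : lipschitz_like S Omega xbar ybar ->
  (multi_norm D < +oo)%E.
Proof.
move=> [kappa lipk]; apply: le_lt_trans multi_norm_le_lip _.
by apply: le_lt_trans (ltry kappa); apply: ereal_inf_lbound; exists kappa.
Qed.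

Lemma mixed_coderivative0Z (a : R) xs : 0 < a -> D 0 xs -> D 0 (a *: xs).
Proof.
move=> a0 [eps_ [x_ [y_ [xs_ [ys_ [ns xsc ysc]]]]]].
exists eps_, x_, y_, (fun k => a *: xs_ k), (fun k => a *: ys_ k); split.
- exact: normal_sequenceZ.
- by move=> x; apply: (cvgM (cvg_cst a) (xsc x)).
- by rewrite -(scaler0 _ a); apply: cvgZ => //; exact: cvg_cst.
Qed.

(** [D 0] is stable under positive scaling, so a nonzero element would make the norm of [D]
    infinite. *)
Lemma multi_norm_coderivative0 : graph_on S Omega (xbar, ybar) ->
  (multi_norm D < +oo)%E -> D 0 = [set 0].
Proof.
move=> gbar Doo; apply/seteqP; split; last first.
  by move=> _ ->; exact: mixed_coderivative00.
move=> xs Dxs; apply/eqP; rewrite -normr_eq0; apply: contraPT Doo => xs0.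
have {}xs0 : 0 < `|xs| by rewrite lt_def xs0 normr_ge0.
have le_multi a : 0 < a -> ((a * `|xs|)%:E <= multi_norm D)%E.
  move=> a0; apply: ereal_sup_ubound; exists 0, (a *: xs); split.
  - by rewrite normr0.
  - exact: mixed_coderivative0Z.
  - by rewrite normrZ gtr0_norm.
(* The value [-oo] is excluded by the bound at [a = 1]. *)
case: (multi_norm D) le_multi => [M|//|] leM; last by have := leM 1 ltr01.
have M0 : 0 < `|M| + 1 by rewrite ltr_wpDl.
have := leM _ (divr_gt0 M0 xs0); rewrite divfK ?gt_eqF// lee_fin.
by rewrite leNgt (le_lt_trans (ler_norm M))// ltrDl.
Qed.

End normal_sequences.

(** * Consequences of a failure of the Lipschitz-like property *)

Section lipschitz_failure.
Context {R : realType} {X Y : completeNormedModType R}.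
Variables (S : X -> set Y) (Omega : set X) (xbar : X) (ybar : Y).
Hypothesis smoothX : frechet_smooth_norm X.
Hypothesis smoothY : frechet_smooth_norm Y.
Hypothesis Omega_closed : closed Omega.
Hypothesis Omega_convex : convex_set Omega.
Hypothesis graph_closed : locally_closed_around (graph S) (xbar, ybar).

Lemma lipschitz_failure_normal (k k' r : R) : 0 < k -> k < k' -> 0 < r ->
  ~ lipschitz_modulus S Omega xbar ybar k' ->
  exists x y xs ys,
    [/\ graph_on S Omega (x, y), `|x - xbar| < r & `|y - ybar| < r] /\
    [/\ eps_normal_cone r (x, y) (graph_on S Omega) (xs, - ys),
        duality_image (tangent_cone x Omega) xs, `|xs| = k & `|ys| <= 1].
Proof.
move=> k0 kk' r0 nlip; have k'0 : 0 < k' by exact: lt_trans kk'.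
have [U [/nbhs_ballP[s /= s0 sU] _ Ucl]] := graph_closed.
pose rho := Num.min r s; have rho0 : 0 < rho by rewrite lt_min r0 s0.
have den0 : 0 < 2 * k' + 4 by rewrite addr_gt0// mulr_gt0.
(* The points found satisfy [|x - xbar| < 3 * eta] and [|y - ybar| < (2 * k' + 1) * eta], both below
   [rho], so they stay in [U] and within [r]. *)
pose eta := rho / (2 * k' + 4).
have eta0 : 0 < eta by rewrite divr_gt0.
have etaE : (2 * k' + 4) * eta = rho by rewrite /eta mulrC divfK ?gt_eqF.
have [xh [x' [y' [Oxh Ox' xhe x'e [y'e Sy' far]]]]] : exists xh x' y',
    [/\ Omega xh, Omega x', `|xh - xbar| < eta, `|x' - xbar| < eta
      & [/\ `|y' - ybar| < eta, S x' y' &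
         forall y, S xh y -> k' * `|x' - xh| < `|y - y'|]].
  apply: contrapT => nex; apply: nlip; split; first exact: ltW.
  exists (ball xbar eta), (ball ybar eta); split; [exact: nbhsx_ballx..|].
  move=> xh x' [Oxh +] [Ox' +] y' [Sy' +].
  rewrite -!ball_normE /= (distrC xbar) (distrC xbar) (distrC ybar).
  move=> xhe x'e y'e; apply: contrapT => nfar; apply: nex.
  exists xh, x', y'; split=> //; split=> // y Sy.
  rewrite ltNge; apply/negP => yy'; apply: nfar; exists y => //.
  set c := k' * _ in yy' *.
  have c0 : 0 <= c by rewrite mulr_ge0// ltW.
  have [cE|cn0] := eqVneq c 0.
    exists 0; first by rewrite /= normr0.
    rewrite scaler0 addr0; apply/subr0_eq/eqP.
    by rewrite -normr_le0 (le_trans yy')// cE.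
  have c_gt0 : 0 < c by rewrite lt_def cn0.
  exists (c^-1 *: (y' - y)).
    by rewrite /= normrZ gtr0_norm ?invr_gt0// ler_pdivrMl// mulr1 distrC.
  by rewrite scalerA divff// scale1r addrC subrK.
have x'xh : `|x' - xh| <= 2 * eta.
  have := ler_distD xbar x' xh; rewrite (distrC xbar); lra.
have close x y : `|x - xh| <= `|x' - xh| -> `|y - y'| <= k' * `|x' - xh| ->
    `|x - xbar| < rho /\ `|y - ybar| < rho.
  move=> xxh yy'; split.
    have := ler_distD xh x xbar; have := mulr_gt0 k'0 eta0.
    by move: etaE; rewrite mulrDl; lra.
  have := ler_distD y' y ybar; have := ler_wpM2l (ltW k'0) x'xh.
  by move: etaE; rewrite mulrDl; lra.
have Unbhs x y : `|x - xh| <= `|x' - xh| -> `|y - y'| <= k' * `|x' - xh| ->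
    nbhs (x, y) U.
  move=> xxh yy'; have [xr yr] := close _ _ xxh yy'.
  apply: filterS sU _; apply: open_nbhs_nbhs; split; first exact: ball_open.
  by split; rewrite -ball_normE/= distrC (lt_le_trans xr, lt_le_trans yr)//
    ge_min lexx orbT.
have [x1 [y1 [xs [ys [[g1 x1xh y1y'] nrm]]]]] :=
  variational_normal smoothX smoothY Omega_closed Omega_convex Ucl Oxh Ox' Sy'
    k0 kk' r0 far Unbhs.
have [xr yr] := close _ _ x1xh y1y'.
exists x1, y1, xs, ys; split=> //; split=> //.
  by rewrite (lt_le_trans xr)// ge_min lexx.
by rewrite (lt_le_trans yr)// ge_min lexx.
Qed.

(** Sequences of constants cover both uses: [k_] unbounded when no modulus exists at all, [k_]
    constant when only small moduli fail. *)
Lemma lipschitz_failure_sequence (k_ k'_ : nat -> R) :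
  (forall n, 0 < k_ n) -> (forall n, k_ n < k'_ n) ->
  (forall n, ~ lipschitz_modulus S Omega xbar ybar (k'_ n)) ->
  exists eps_ x_ y_ xs_ ys_,
    [/\ normal_sequence S Omega xbar ybar eps_ x_ y_ xs_ ys_,
        forall n, `|xs_ n| = k_ n & forall n, `|ys_ n| <= 1].
Proof.
move=> k0 kk' nlip.
pose P n (q : X * Y * (dual X * dual Y)) :=
  [/\ graph_on S Omega q.1, `|q.1.1 - xbar| < n.+1%:R^-1
     & `|q.1.2 - ybar| < n.+1%:R^-1] /\
  [/\ eps_normal_cone n.+1%:R^-1 q.1 (graph_on S Omega) (q.2.1, - q.2.2),
     duality_image (tangent_cone q.1.1 Omega) q.2.1, `|q.2.1| = k_ n
     & `|q.2.2| <= 1].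
have /choice[q qP] n : exists q, P n q.
  have n0 : 0 < n.+1%:R^-1 :> R by rewrite invr_gt0.
  have [x [y [xs [ys xyP]]]] :=
    lipschitz_failure_normal (k0 n) (kk' n) n0 (nlip n).
  by exists ((x, y), (xs, ys)).
exists (fun n => n.+1%:R^-1), (fun n => (q n).1.1), (fun n => (q n).1.2),
  (fun n => (q n).2.1), (fun n => (q n).2.2).
have q1 n : ((q n).1.1, (q n).1.2) = (q n).1 by case: ((q n).1).
have harm (V : normedModType R) (v : V) (u : nat -> V) :
    (forall n, `|u n - v| < n.+1%:R^-1) -> u @ \oo --> v.
  move=> uv; apply/cvgrPdist_lt => e e0; near=> n; rewrite distrC.
  by apply: lt_trans (uv n) _; near: n; exact: (near_infty_natSinv_lt (PosNum e0)).
split; first split; try by move=> n; case: (qP n) => _ [].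
- exact: cvg_harmonic.
- by move=> n; rewrite q1; have [[]] := qP n.
- by apply: cvg_pair; apply: harm => n; have [[]] := qP n.
Unshelve. all: by end_near. Qed.

Lemma not_lipschitz_le k : 0 <= k -> ~ lipschitz_like S Omega xbar ybar ->
  ~ lipschitz_modulus S Omega xbar ybar k.
Proof. by move=> k0 nlip lipk; apply: nlip; exists k. Qed.

(** Dividing normals with [|xs_ n| = n + 1] and [|ys_ n| <= 1] by [n + 1] gives unit functionals on
    [X], while those on [Y] tend to 0. A weak-star limit lies in the mixed coderivative at 0, hence
    is 0, and PSNC contradicts the unit norms. *)
Lemma psnc_lipschitz_like : reflexive_space X -> psnc S Omega xbar ybar ->
  mixed_coderivative S Omega xbar ybar 0 = [set 0] ->
  lipschitz_like S Omega xbar ybar.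
Proof.
move=> Xrefl spsnc D0; apply: contrapT => nlip.
have [||n|eps_ [x_ [y_ [xs_ [ys_ [ns xsn ysn]]]]]] :=
  @lipschitz_failure_sequence (fun n => n.+1%:R) (fun n => n.+2%:R).
- by move=> n; rewrite ltr0n.
- by move=> n; rewrite ltr_nat.
- exact: not_lipschitz_le.
pose a_ n : R := n.+1%:R^-1.
have a0 n : 0 < a_ n by rewrite invr_gt0 ltr0n.
have axs n : `|a_ n *: xs_ n| = 1.
  by rewrite normrZ gtr0_norm// xsn mulVf// pnatr_eq0.
have axs1 n : `|a_ n *: xs_ n| <= 1 by rewrite axs.
have [phi [xs [phik xsc]]] := bounded_weak_star_subsequence Xrefl axs1.
have ays : a_ n *: ys_ n @[n --> \oo] --> (0 : dual Y).
  apply/norm_cvg0P; apply: (squeeze_cvgr _ (cvg_cst 0) (@cvg_harmonic R)).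
  apply: nearW => n; rewrite normr_ge0/= normrZ gtr0_norm//.
  by rewrite ler_piMr// ltW.
have ns' := normal_sequence_sub phik (normal_sequenceZ a0 ns).
have ays' := cvg_comp _ _ (cvg_subsequence phik) ays.
have Dxs : mixed_coderivative S Omega xbar ybar 0 xs.
  by do 5!eexists; split; [exact: ns'|exact: xsc|exact: ays'].
move: Dxs; rewrite D0 => xs0; rewrite xs0 in xsc.
have /cvgrPdist_lt/(_ 1 ltr01)[N _] := spsnc _ _ _ _ _ ns' xsc ays'.
by move=> /(_ N (leqnn N)); rewrite /= sub0r normrN normr_id axs ltxx.
Qed.

(** If [M < k < lip], there are normals with [|xs| = k] and [|ys| <= 1]. In finite dimension the
    norm [k] survives the limit, whereas [ys] is only controlled weak-star; hence the normal
    coderivative in the bound. *)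
Lemma lip_le_normal_coderivative : reflexive_space X -> reflexive_space Y ->
  finite_dimensional X -> graph_on S Omega (xbar, ybar) ->
  (lip S Omega xbar ybar <=
    multi_norm (normal_coderivative S Omega xbar ybar))%E.
Proof.
move=> Xrefl Yrefl Xfin gbar; rewrite leNgt; apply/negP.
(* Rules out [-oo], so that the norm can be taken to be a real [M]. *)
have : (0%:E <= multi_norm (normal_coderivative S Omega xbar ybar))%E.
  apply: ereal_sup_ubound; exists 0, 0; split; rewrite ?normr0//.
  exact: normal_coderivative00.
case E : (multi_norm _) => [M| |] // M0; last by rewrite ltNge leey.
rewrite lee_fin in M0; move=> Mlip.
(* [lip] may be infinite, so a real [k'] is chosen strictly between. *)
have [k' [Mk' k'lip]] : exists k', M < k' /\ (k'%:E < lip S Omega xbar ybar)%E.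
  move: Mlip; case: (lip _ _ _ _) => [l| |//].
    rewrite lte_fin => Ml; exists ((M + l) / 2).
    by rewrite lte_fin; split; lra.
  by move=> _; exists (M + 1); rewrite ltry ltrDl.
have [k [Mk kk']] : exists k, M < k /\ k < k'.
  by exists ((M + k') / 2); split; lra.
have [||n|eps_ [x_ [y_ [xs_ [ys_ [ns xsn ysn]]]]]] :=
  @lipschitz_failure_sequence (fun=> k) (fun=> k').
- by move=> _; exact: le_lt_trans Mk.
- by [].
- move=> lipk'; move: k'lip; rewrite ltNge => /negP; apply.
  by apply: ereal_inf_lbound; exists k'.
have xsk n : `|xs_ n| <= k by rewrite xsn.
have [phi [xs [phik xsc]]] := bounded_weak_star_subsequence Xrefl xsk.
have [psi [ys [psik ysc]]] :=
  bounded_weak_star_subsequence Yrefl (fun n => ysn (phi n)).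
have ns' := normal_sequence_sub psik (normal_sequence_sub phik ns).
have xsc' : weak_star_cvg ((xs_ \o phi) \o psi) xs.
  by move=> x; exact: (cvg_comp _ _ (cvg_subsequence psik) (xsc x)).
have xs_k : `|xs| = k.
  have ck : `|xs_ (phi n)| @[n --> \oo] --> `|xs|.
    exact: (cvg_norm (finite_dimensional_weak_star_cvg Xfin xsc)).
  have kE : (fun n => `|xs_ (phi n)|) = cst k by apply/funext => n; exact: xsn.
  rewrite kE in ck; apply: (cvg_unique _ ck) => //; exact: cvg_cst.
have ys1 : `|ys| <= 1.
  apply: (weak_star_norm_le (b_ := cst 1) ysc); last exact: cvg_cst.
  by apply: nearW => n; exact: ysn.
have : (`|xs|%:E <= M%:E)%E.
  rewrite -E; apply: ereal_sup_ubound; exists ys, xs; split=> //.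
  by do 5!eexists; split; [exact: ns'|exact: xsc'|exact: ysc].
by rewrite lee_fin xs_k leNgt Mk.
Qed.

End lipschitz_failure.

Theorem theorem4p5 (R : realType) (X Y : completeNormedModType R)
    (hX : renormed_reflexive X) (hY : renormed_reflexive Y)
    (S : X -> set Y) (Omega : set X) (xbar : X) (ybar : Y)
    (hbar : graph_on S Omega (xbar, ybar)) :
  let D := mixed_coderivative S Omega xbar ybar in
  let Dn := normal_coderivative S Omega xbar ybar in
  let i := lipschitz_like S Omega xbar ybar in
  let ii := psnc S Omega xbar ybar /\ (multi_norm D < +oo)%E in
  let iii := psnc S Omega xbar ybar /\ D 0 = [set 0] in
  let closed_data :=
    [/\ closed Omega, convex_set Omega &
        locally_closed_around (graph S) (xbar, ybar)] in
  [/\ (i -> ii) /\ (ii -> iii),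
      closed_data -> iii -> i,
      closed_data -> finite_dimensional X ->
        (lip S Omega xbar ybar <= multi_norm Dn)%E,
      (multi_norm D <= lip S Omega xbar ybar)%E
    & closed_data -> finite_dimensional X ->
      coderivatively_normal S Omega xbar ybar ->
        lip S Omega xbar ybar = multi_norm D /\ multi_norm D = multi_norm Dn].
Proof.
move: hX hY => [Xrefl _ _ Xsmooth] [Yrefl _ _ Ysmooth] D Dn i ii iii cd.
have lip_le : cd -> finite_dimensional X ->
    (lip S Omega xbar ybar <= multi_norm Dn)%E.
  by move=> [Ocl Ocvx gcl] Xfin; exact: lip_le_normal_coderivative.
split=> //; last 2 first.
- exact: multi_norm_le_lip.
- move=> hcd Xfin DDn; split=> //; apply/eqP; rewrite eq_le.
  apply/andP; split; last exact: multi_norm_le_lip.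
  (* Coderivative normality turns the upper bound by the norm of [Dn] into one by the norm of
     [D]. *)
  by rewrite [leRHS]DDn; exact: lip_le.
- split=> [hi|[hpsnc Doo]].
    by split; [exact: lipschitz_like_psnc|exact: lipschitz_like_multi_norm].
  by split=> //; exact: multi_norm_coderivative0.
- by move=> [Ocl Ocvx gcl] [hpsnc D0]; exact: psnc_lipschitz_like.
Qed.
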